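(* Consider the discrete-time infinite single-hop network on $\mathbb{Z}^d$ described in the context, with service algorithm (D1) or (D2), in the symmetric case in which the random variables $\xi_i$, $i\in\mathbb{Z}^d$, are i.i.d. with $\mathbb{E}\xi_i=\lambda$. Assume $$\lambda<\frac{1}{\sum_{j\in\mathbb{Z}^d}a_j}$$ and $\mathbb{E}\xi_i^3<\infty$. Then the system is stable and its lower invariant measure (i.e., the stationary distribution dominated by any other) is such that $\mathbb{E}X_i^2<\infty$ for all $i$.
   Context: Rates. Let $(a_i)_{i\in\mathbb{Z}^d}$ satisfy $a_0=1$, $a_i=a_{-i}\ge0$ and $L=\sup\{|i|:a_i>0\}<\infty$. Set $\mathcal{N}_i=\{j:a_{j-i}>0\}$ (the neighbours of $i$, including $i$) and $$\psi_i(\bar x)=\frac{x_i}{\sum_{j\in\mathbb{Z}^d}a_{j-i}x_j},\qquad 0/0:=0.$$ Dynamics. The state is $\bar X(k)\in\mathbb{Z}_+^{\mathbb{Z}^d}$, with $X_i(k+1)=X_i(k)+\xi_i(k)-\eta_i(k)$, where $\xi_i(k)$ is the number of arrivals to node $i$ in slot $k$ and $\eta_i(k)\in\{0,1\}$ indicates that node $i$ transmits (serves one job, which leaves the network) in slot $k$. The $\xi_i(k)$ are independent over $i$ and $k$ and, for each $i$, i.i.d. over $k$ with generic copy $\xi_i$. The services are driven by random variables $U_i(k)$, i.i.d. over $i,k$, uniform on $[0,1]$, independent of the arrivals, by one of two algorithms: (D1) let $\tau_i(k)=[-\log U_i(k)]/X_i(k)$ ($=\infty$ if $X_i(k)=0$);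 node $i$ transmits in slot $k$ iff $X_i(k)>0$ and $\tau_i(k)<\tau_j(k)/a_{j-i}$ for all $j\in\mathcal{N}_i\setminus\{i\}$; (D2) node $i$ transmits in slot $k$ iff $X_i(k)>0$ and $U_i(k)<\psi_i(\bar X(k))$. Stability of the infinite network means existence of a proper stationary distribution of $\bar X(\cdot)$ (all queues finite with probability 1). ''Dominated'' refers to stochastic domination with respect to the component-wise order on $\mathbb{Z}_+^{\mathbb{Z}^d}$. *)

(* Defs.v *)
(* MathComp-Analysis. *)
From HB Require Import structures.
From mathcomp Require Import all_boot all_order all_algebra.
From mathcomp Require Import all_classical all_reals all_analysis.

Set Implicit Arguments.
Unset Strict Implicit.
Unset Printing Implicit Defensive.

Import Order.TTheory GRing.Theory Num.Theory.
Import numFieldNormedType.Exports.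

Local Open Scope classical_set_scope.
Local Open Scope ring_scope.

Definition site (d : nat) := 'rV[int]_d.

Definition coordinate_events (d : nat) : set (set (site d -> nat)) :=
  [set C | exists i (B : set nat), C = [set x | B (x i)]].

(* Queue-length configurations, with the product sigma-algebra: the one
   generated by the coordinate maps (nat carries the discrete one). All queues
   are finite, so a probability on this type is a proper distribution. *)
Definition state (d : nat) := g_sigma_algebraType (@coordinate_events d).

(* Finiteness of the range uses the sup norm on Z^d; all norms give the same
   condition. *)
Record interference_rates (R : realType) (d : nat) (a : site d -> R) : Prop := {
  rate0 : a 0 = 1;
  rate_sym : forall i, a i = a (- i);
  rate_ge0 : forall i, 0 <= a i;
  rate_range : exists L : int,
    forall i, 0 < a i -> forall k : 'I_d, `|i ord0 k| <= L
}.

(* Under interference_rates the sum has finite support; MathComp's r / 0 = 0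
   provides the convention 0 / 0 = 0. *)
Definition psi (R : realType) (d : nat) (a : site d -> R)
    (x : state d) (i : site d) : R :=
  (x i)%:R / \sum_(j \in [set: site d]) (a (j - i) * (x j)%:R).

Inductive service_algorithm := D1 | D2.

(* The logarithm is taken in the extended reals, where lne 0 = -oo, since the
   real-valued ln satisfies ln 0 = 0. *)
Definition tau (R : realType) (d : nat) (x : state d) (u : site d -> R)
    (i : site d) : \bar R :=
  (if x i == 0%N then +oo else (- lne (u i)%:E) / ((x i)%:R)%:E)%E.

Definition transmits (R : realType) (d : nat) (alg : service_algorithm)
    (a : site d -> R) (x : state d) (u : site d -> R) (i : site d) : bool :=
  match alg with
  | D1 => (0 < x i)%N &&
      `[< forall j, 0 < a (j - i) -> j != i ->
            (tau x u i < tau x u j / (a (j - i))%:E)%E >]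
  | D2 => (0 < x i)%N && (u i < psi a x i)
  end.

Definition step (R : realType) (d : nat) (alg : service_algorithm)
    (a : site d -> R) (xi : site d -> nat) (u : site d -> R)
    (x : state d) : state d :=
  fun i => (x i + xi i - transmits alg a x u i)%N.

Fixpoint queues (R : realType) (d : nat) (alg : service_algorithm)
    (a : site d -> R) (xi : nat -> site d -> nat) (u : nat -> site d -> R)
    (x : state d) (k : nat) : state d :=
  if k is k'.+1
  then step alg a (xi k') (u k') (queues alg a xi u x k')
  else x.

Definition mutually_independent (R : realType) (dO : measure_display)
    (Omega : measurableType dO) (P : probability Omega R)
    (I : eqType) (F : I -> set (set Omega)) : Prop :=
  forall (s : seq I) (B : I -> set Omega), uniq s ->
    (forall e, e \in s -> F e (B e)) ->
    P (\bigcap_(e in [set` s]) B e) = (\prod_(e <- s) P (B e))%E.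

(* One sigma-algebra for each arrival variable (inl) and each service variable
   (inr). Joint mutual independence of this family says that the arrivals are
   independent, that the service variables are independent, and that the two
   families are independent of each other. *)
Definition driving_events (R : realType) (d : nat) (dO : measure_display)
    (Omega : measurableType dO) (P : probability Omega R)
    (xi : nat -> site d -> {RV P >-> nat}) (U : nat -> site d -> {RV P >-> R})
    (e : (nat * site d) + (nat * site d)) : set (set Omega) :=
  match e with
  | inl (k, i) => g_sigma_algebra_preimage (xi k i)
  | inr (k, i) => g_sigma_algebra_preimage (U k i)
  end.

Section stationarity.
Context (R : realType) (d : nat) (alg : service_algorithm) (a : site d -> R)
  (dO : measure_display) (Omega : measurableType dO) (P : probability Omega R)
  (xi : nat -> site d -> {RV P >-> nat}) (U : nat -> site d -> {RV P >-> R}).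

(* Started from X(0) ~ mu independent of the driving variables (realized as the
   first projection of the product space), X(k) ~ mu for every k. *)
Definition stationary (mu : probability (state d) R) : Prop :=
  forall (k : nat) (A : set (state d)), measurable A ->
    (mu \x P)%E
      [set z | A (queues alg a (fun l i => xi l i z.2) (fun l i => U l i z.2)
                    z.1 k)] = mu A.

Definition stable : Prop := exists mu, stationary mu.

Definition dominated (mu nu : probability (state d) R) : Prop :=
  forall f : state d -> R, measurable_fun [set: state d] f ->
    (exists M : R, forall x, `|f x| <= M) ->
    (forall x y : state d, (forall i, (x i <= y i)%N) -> f x <= f y) ->
    (\int[mu]_x (f x)%:E <= \int[nu]_x (f x)%:E)%E.

Definition lower_invariant (mu : probability (state d) R) : Prop :=
  stationary mu /\ forall nu, stationary nu -> dominated mu nu.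

End stationarity.

(* Main.v *)
(** The dynamics is monotone in the queue lengths, so running it backwards in
    time from the empty network gives queues Y_n increasing with n, with the law
    of the network started empty at time n; the law of their limit is invariant
    and lies below every invariant law once the limit is finite.

    Finiteness comes from a cubic Lyapunov function.  Put A = \sum_j a_j.  Node 0
    transmits with probability at least psi_0 = X_0 / S with S = \sum_j a_j X_j,
    and the tangent bound 1/S >= 2/(A X_0) - S/(A X_0)^2 gives
    E X_0^2 psi_0 >= 2 E X_0^2 / A - E X_0 S / A^2 >= E X_0^2 / A, because
    E X_0 X_j <= E X_0^2 by translation invariance.  Hence
    E Y_(n+1)^3 - E Y_n^3 <= - 3 (1/A - lambda) E Y_n^2 + O(E Y_n + 1), and as the
    left-hand side is nonnegative, E Y_n^2 is bounded uniformly in n.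

    Comparing the limit law with an invariant one is immediate on increasing sets
    that depend on finitely many sites.  An arbitrary increasing event is
    approximated from inside by the increasing hull of a closed set, which is a
    decreasing intersection of such sets. *)
Require Import Defs.
From HB Require Import structures.
From mathcomp Require Import all_boot all_order all_algebra.
From mathcomp Require Import all_classical all_reals all_analysis.
From mathcomp Require Import measurable_realfun zify lra ring.

Set Implicit Arguments.
Unset Strict Implicit.
Unset Printing Implicit Defensive.

Import Order.TTheory GRing.Theory Num.Theory.
Import numFieldNormedType.Exports.

Local Open Scope classical_set_scope.
Local Open Scope ring_scope.

(** * Interference neighbourhoods and one step of the dynamics *)

(** Both algorithms obey the same one-slot estimate. For a fixed state the clocks [-ln U_i / X_i]
    and [-ln U_j / (a_(j-i) X_j)] of (D1) are independent exponential variables, so node i wins its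
    race with probability [psi_i], the value that (D2) prescribes directly. No conditional
    expectation is formed. The assumptions on arrivals and services are condensed into one product
    formula for a field indexed by slot and site; reversing finitely many slots, translating in
    space and splicing blocks of two independent copies all preserve this formula, and conditioning
    becomes integration over a product space. The third moment of the arrivals keeps [E Y_n^3]
    finite for each n separately, without which it could not be cancelled from the drift inequality.
    The limit of the Y_n may enter an increasing event that no Y_n enters, when that event
    constrains all sites at once; this is why the comparison goes through finitely many sites.
    Finally, an arbitrary lower invariant measure is only compared with the constructed one, so its
    second moment is controlled without identifying the two. *)

Section neighbourhood.
Context (R : realType) (d : nat) (a : site d -> R).
Hypothesis ha : interference_rates a.

Lemma finite_neighbourhood : finite_set [set h | 0 < a h].
Proof.
have [L aL] := rate_range ha.
(* The box of radius [m] is the image of a finite function space: coordinates are shifted by [m] to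
   land in ['I_(m.*2.+1)]. *)
pose m := `|L|%N.
pose F (f : {ffun 'I_d -> 'I_(m.*2.+1)}) : site d :=
  \row_k ((f k)%:Z - m%:Z).
apply: (@sub_finite_set _ _ (F @` setT)); last first.
  by apply: finite_image; exact: finite_finset.
move=> h /= /aL hL; exists [ffun k => inord `|(h ord0 k + m%:Z)%R|%N] => //.
apply/rowP => k; rewrite mxE ffunE; have := hL k => {hL aL} hk.
have {}hk : `|h ord0 k| <= m%:Z :> int.
  by rewrite /m (le_trans hk)// abszE ler_norm.
move: hk; rewrite ler_norml => /andP[h1 h2].
have h3 : (0 <= h ord0 k + m%:Z) by rewrite -lerBlDr sub0r.
rewrite inordK; first by rewrite gez0_abs// addrK.
rewrite -ltz_nat gez0_abs// -addnn; lia.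
Qed.

Lemma neighbourhood_exists : {N : seq (site d) | uniq N &
  forall h, (h \in N) = (0 < a h)}.
Proof.
apply: cid2; have /finite_seqP[N NE] := finite_neighbourhood.
exists (undup N); first exact: undup_uniq.
move=> h; rewrite mem_undup; apply/idP/idP => [hN|h0].
  by have : [set` N] h by []; rewrite -NE.
by have : [set h | 0 < a h] h by []; rewrite NE.
Qed.

Definition neighbours : seq (site d) := s2val neighbourhood_exists.

Lemma neighbours_uniq : uniq neighbours.
Proof. exact: (s2valP neighbourhood_exists). Qed.

Lemma mem_neighbours h : (h \in neighbours) = (0 < a h).
Proof. exact: (s2valP' neighbourhood_exists). Qed.

Lemma mem0_neighbours : 0 \in neighbours.
Proof. by rewrite mem_neighbours rate0// ltr01. Qed.

(** Indexing by offsets gives one finite list for all sites, which makes locality and translation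
    invariance immediate. *)
Lemma fsbig_neighbours (F : site d -> R) i :
  \sum_(j \in [set: site d]) (a (j - i) * F j) =
  \sum_(h <- neighbours) a h * F (i + h).
Proof.
have -> : \sum_(h <- neighbours) a h * F (i + h) =
    \sum_(j <- [seq i + h | h <- neighbours]) a (j - i) * F j.
  by rewrite big_map; apply: eq_bigr => h _; rewrite [i + h]addrC addrK.
rewrite [RHS]fsbig_seq; last by rewrite map_inj_uniq ?neighbours_uniq//; exact: addrI.
apply/esym/fsbig_widen => // j /= [_] jN; rewrite /=.
suff -> : a (j - i) = 0 by rewrite mul0r.
apply/eqP; rewrite eq_le rate_ge0// andbT leNgt; apply/negP => aji; apply: jN.
by apply/mapP; exists (j - i); rewrite ?mem_neighbours// addrC subrK.
Qed.

Definition total_rate : R := \sum_(h <- neighbours) a h.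

Lemma total_rateE : \sum_(j \in [set: site d]) a j = total_rate.
Proof.
transitivity (\sum_(j \in [set: site d]) (a (j - 0) * 1)).
  by apply: eq_fsbigr => j _; rewrite subr0 mulr1.
by rewrite (fsbig_neighbours (fun=> 1)); apply: eq_bigr => h _; rewrite mulr1.
Qed.

Lemma total_rate_gt0 : 0 < total_rate.
Proof.
rewrite /total_rate (bigD1_seq 0) ?mem0_neighbours ?neighbours_uniq//=.
by rewrite rate0// ltr_pwDl// sumr_ge0// => h _; exact: rate_ge0.
Qed.

Lemma psiE (x : state d) i :
  psi a x i = (x i)%:R / \sum_(h <- neighbours) a h * (x (i + h))%:R.
Proof. by rewrite /psi (fsbig_neighbours (fun j => (x j)%:R)). Qed.

Lemma interference_ge (x : state d) i :
  (x i)%:R <= \sum_(h <- neighbours) a h * (x (i + h))%:R.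
Proof.
rewrite (bigD1_seq 0) ?mem0_neighbours ?neighbours_uniq//=.
rewrite rate0// mul1r addr0 lerDl sumr_ge0// => h _.
by rewrite mulr_ge0// rate_ge0.
Qed.

Lemma psi_ge0 (x : state d) i : 0 <= psi a x i.
Proof.
by rewrite psiE divr_ge0// (le_trans _ (interference_ge _ _)).
Qed.

Lemma psi_le1 (x : state d) i : psi a x i <= 1.
Proof.
rewrite psiE; have := interference_ge x i; set S := \sum_(h <- _) _ => xS.
have [/eqP x0|x0] := boolP (x i == 0%N).
  by rewrite x0 mul0r.
have S0 : 0 < S by rewrite (lt_le_trans _ xS)// ltr0n lt0n.
by rewrite ler_pdivrMr// mul1r.
Qed.

Lemma psi_anti (x y : state d) i : (forall j, (x j <= y j)%N) -> x i = y i ->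
  psi a y i <= psi a x i.
Proof.
move=> xy xyi; rewrite !psiE -xyi.
have [/eqP x0|x0] := boolP (x i == 0%N).
  by rewrite x0 !mul0r.
apply: ler_wpM2l => //.
have S0 : 0 < \sum_(h <- neighbours) a h * (x (i + h))%:R.
  by rewrite (lt_le_trans _ (interference_ge _ _))// ltr0n lt0n.
have Sxy : \sum_(h <- neighbours) a h * (x (i + h))%:R <=
    \sum_(h <- neighbours) a h * (y (i + h))%:R.
  by apply: ler_sum => h _; rewrite ler_wpM2l ?rate_ge0// ler_nat.
by rewrite lef_pV2// posrE (lt_le_trans S0).
Qed.

(** Since [u j <= 1], the numerator [- lne (u j)] is nonnegative, and a longer queue can only
    shorten the clock. *)
Lemma tau_anti (x y : state d) (u : site d -> R) j :
  u j <= 1 -> (x j <= y j)%N -> (tau y u j <= tau x u j)%E.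
Proof.
move=> u1 xy; rewrite /tau.
have [x0|x0] := eqVneq (x j) 0%N; first by rewrite leey.
have y0 : y j != 0%N by rewrite -lt0n (leq_trans _ xy)// lt0n.
rewrite (negbTE y0) !inver !pnatr_eq0 (negbTE x0) (negbTE y0).
apply: lee_wpmul2l; first by rewrite leeNr oppe0 lne_le0 lee_fin.
by rewrite lee_fin lef_pV2 ?posrE ?ltr0n ?lt0n// ler_nat.
Qed.

Lemma tau_local (x y : state d) (u : site d -> R) j : x j = y j ->
  tau x u j = tau y u j.
Proof. by rewrite /tau => ->. Qed.

(** With its own queue fixed, a node only loses from longer queues elsewhere: rival clocks run
    faster under (D1), and the denominator of [psi] grows under (D2). *)
Lemma transmits_anti alg (x y : state d) (u : site d -> R) i :
  (forall j, u j <= 1) -> (forall j, (x j <= y j)%N) -> x i = y i ->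
  transmits alg a y u i -> transmits alg a x u i.
Proof.
move=> u1 xy xyi; case: alg => /= /andP[y0 h]; rewrite xyi y0/=; last first.
  by rewrite (lt_le_trans h)// psi_anti.
move: h => /asboolP h; apply/asboolP => j aji ji.
rewrite (tau_local _ xyi); apply: (lt_le_trans (h j aji ji)).
rewrite inver gt_eqF//; apply: lee_wpmul2r; first by rewrite lee_fin invr_ge0 ltW.
exact: tau_anti.
Qed.

Lemma transmits_local alg (x y : state d) (u : site d -> R) i :
  (forall h, h \in neighbours -> x (i + h) = y (i + h)) ->
  transmits alg a x u i = transmits alg a y u i.
Proof.
move=> xy; have xyi : x i = y i.
  by have := xy 0; rewrite addr0 mem0_neighbours => ->.
case: alg => /=; rewrite xyi; congr andb; last first.
  congr (_ < _); rewrite !psiE xyi; congr (_ / _).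
  by apply: eq_big_seq => h hN; rewrite xy.
apply: asbool_equiv_eq; split => H j aji ji; have := H j aji ji;
  rewrite (tau_local _ xyi) (_ : tau y u j = tau x u j)//; apply: tau_local;
  by rewrite -(subrK i j) addrC xy// mem_neighbours.
Qed.

Lemma transmits_translate alg (x : state d) (u : site d -> R) s i :
  transmits alg a (fun j => x (j + s)) (fun j => u (j + s)) i =
  transmits alg a x u (i + s).
Proof.
case: alg => /=; congr andb; last first.
  congr (_ < _); rewrite !psiE; congr (_ / _).
  by apply: eq_bigr => h _; rewrite addrAC.
apply: asbool_equiv_eq; split => H j aji ji.
  have := H (j - s); rewrite -addrA -opprD [s + i]addrC /tau /= subrK; apply => //.
  by apply: contra ji => /eqP <-; rewrite subrK.
have := H (j + s); rewrite opprD addrACA subrr addr0; apply => //.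
by apply: contra ji => /eqP /addIr ->.
Qed.

(** Where the two queues agree, the smaller configuration transmits whenever the larger one does.
    Where they differ, the gap is at least one, and one slot removes at most one job. *)
Lemma step_mono alg (xi : site d -> nat) (u : site d -> R) (x y : state d) i :
  (forall j, u j <= 1) -> (forall j, (x j <= y j)%N) ->
  (step alg a xi u x i <= step alg a xi u y i)%N.
Proof.
move=> u1 xy; rewrite /step; have := xy i; rewrite leq_eqVlt => /predU1P[xyi|xyi].
  have h := transmits_anti (alg := alg) u1 xy xyi; rewrite xyi.
  by apply: leq_sub2l; case: (transmits _ _ y _ _) h => [->|].
apply: (@leq_trans (x i + xi i)); first exact: leq_subr.
case: (transmits _ _ _); lia.
Qed.

Lemma step_local alg (xi : site d -> nat) (u : site d -> R) (x y : state d) i :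
  (forall h, h \in neighbours -> x (i + h) = y (i + h)) ->
  step alg a xi u x i = step alg a xi u y i.
Proof.
move=> xy; rewrite /step (transmits_local _ _ xy).
by have := xy 0; rewrite addr0 mem0_neighbours => ->.
Qed.

Lemma step_translate alg (xi : site d -> nat) (u : site d -> R) (x : state d) s i :
  step alg a (fun j => xi (j + s)) (fun j => u (j + s)) (fun j => x (j + s)) i =
  step alg a xi u x (i + s).
Proof. by rewrite /step transmits_translate. Qed.

End neighbourhood.

(** * The backward construction *)

(** The arrival and the service variable of one slot and site are kept as a pair, so that a single
    index set carries all the randomness and every change of time or space is a reindexing. *)
Definition driver_cylinders (R : realType) (d : nat) :
    set (set (nat * site d -> nat * R)) :=
  [set C | exists e (B : set nat) (B' : set R), measurable B' /\
    C = [set w | B (w e).1 /\ B' (w e).2]].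

Definition driver (R : realType) (d : nat) :=
  g_sigma_algebraType (@driver_cylinders R d).

Section backward_recursion.
Context (R : realType) (d : nat) (a : site d -> R) (alg : service_algorithm).
Implicit Types w : driver R d.

(* Truncation at 1 makes every tau nonnegative, which the monotonicity of the
   dynamics needs for all realizations and not only almost surely. *)
Definition service w (k : nat) (i : site d) : R := Num.min (w (k, i)).2 1.

Definition arrival w (k : nat) (i : site d) : nat := (w (k, i)).1.

Definition run w (x : state d) (k : nat) : state d :=
  queues alg a (arrival w) (service w) x k.

Definition time_shift (k : nat) w : driver R d := fun e => w ((k + e.1)%N, e.2).

(** Slots from [k] on stay in place, so the underlying map of indices is an involution of all slots
    and preserves the law of an independent field. *)
Definition reversal (k : nat) w : driver R d :=
  fun e => if (e.1 < k)%N then w ((k.-1 - e.1)%N, e.2) else w e.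

Definition space_shift (s : site d) w : driver R d := fun e => w (e.1, e.2 + s).

(** Slot 0 is the newest and is applied last: raising [n] inserts an older slot and leaves the newer
    ones unchanged. *)
Fixpoint backward (n : nat) w : state d :=
  if n is n'.+1
  then step alg a (arrival w 0) (service w 0) (backward n' (time_shift 1 w))
  else fun=> 0%N.

(** The default 0 at a site without a limit makes this a total map into finite configurations, and
    upper bounds on moments hold there trivially. *)
Definition backward_limit w : state d :=
  fun i => xget 0%N [set v | \forall n \near \oo, backward n w i = v].

Definition backward_cvg w :=
  forall i, exists v, \forall n \near \oo, backward n w i = v.

Lemma time_shift0 w : time_shift 0 w = w.
Proof. by apply/funext => -[k i]; rewrite /time_shift add0n. Qed.

Lemma time_shift_add k l w : time_shift k (time_shift l w) = time_shift (l + k) w.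
Proof. by apply/funext => -[m i]; rewrite /time_shift/= addnA. Qed.

Lemma run_ext w w' (x : state d) k :
  (forall l i, (l < k)%N -> w (l, i) = w' (l, i)) -> run w x k = run w' x k.
Proof.
elim: k => // k IH ww' /=; rewrite /run/=.
rewrite -/(run w x k) -/(run w' x k) IH; last first.
  by move=> l i lk; rewrite ww'// ltnW.
congr step; apply/funext => i; first by rewrite /arrival ww'.
by rewrite /service ww'.
Qed.

(** This identity links the two directions of time: the [k] newest slots, read from oldest to
    newest, act as a forward run on the backward state built from older slots only. Invariance of
    the limit law comes from letting [n] grow. *)
Lemma backward_run n k w :
  backward (n + k) w = run (reversal k w) (backward n (time_shift k w)) k.
Proof.
elim: k w => [w|k IH w]; first by rewrite addn0 time_shift0.
rewrite addnS /= /run/= -/(run _ _ k) IH time_shift_add add1n.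
rewrite (@run_ext _ (reversal k.+1 w)); last first.
  move=> l i lk; rewrite /reversal /time_shift/= lk ltnS ltnW//.
  by congr (w (_, _)); lia.
by congr step; apply/funext => i; rewrite /arrival /service /reversal/= ltnSn subnn.
Qed.

Lemma backward_run0 k w : backward k w = run (reversal k w) (fun=> 0%N) k.
Proof. by rewrite -[k in LHS]add0n backward_run. Qed.

Hypothesis ha : interference_rates a.

Lemma run_mono w (x y : state d) k : (forall i, (x i <= y i)%N) ->
  forall i, (run w x k i <= run w y k i)%N.
Proof.
move=> xy; elim: k => // k IH i; rewrite /run/=; apply: step_mono => // j.
by rewrite /service ge_min lexx orbT.
Qed.

(** The empty state lies below everything; the comparison then propagates from the oldest slot to
    the newest by monotonicity of a step. *)
Lemma backward_leS n w i : (backward n w i <= backward n.+1 w i)%N.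
Proof.
elim: n w i => [//|n IH w i]; rewrite [backward n.+2 w]/= [backward n.+1 w]/=.
by apply: step_mono => // j; rewrite /service ge_min lexx orbT.
Qed.

Lemma backward_homo w i : {homo (fun n => backward n w i) : m n / (m <= n)%N}.
Proof. by apply: homo_leq => // [y x z|n]; [exact: leq_trans|exact: backward_leS]. Qed.

Lemma backward_space_shift n s w i :
  backward n (space_shift s w) i = backward n w (i + s).
Proof.
elim: n w i => // n IH w i /=.
rewrite -(step_translate ha alg (arrival w 0) (service w 0)).
by congr (step _ _ _ _ _ i); apply/funext => j; rewrite -IH.
Qed.

(** Interference has finite range, so a queue after [k] slots depends on finitely many initial
    queues, and finitely many eventual equalities hold together. *)
Lemma run_near w (Z : nat -> state d) (z : state d) k :
  (forall i, \forall n \near \oo, Z n i = z i) ->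
  forall i, \forall n \near \oo, run w (Z n) k i = run w z k i.
Proof.
move=> Zz; elim: k => // k IH i.
have : \forall n \near \oo, forall h, h \in neighbours ha ->
    run w (Z n) k (i + h) = run w z k (i + h).
  elim: (neighbours ha) => [|h s IHs]; first by near=> n.
  near=> n => h'; rewrite in_cons => /orP[/eqP ->|].
    by near: n; exact: IH.
  by move: h'; near: n.
by apply: filterS => n hn; rewrite /run/=; exact: step_local.
Unshelve. all: by end_near. Qed.

Lemma backward_limit_near w i v :
  (\forall n \near \oo, backward n w i = v) -> backward_limit w i = v.
Proof.
move=> wv; rewrite /backward_limit; apply: xget_subset1 => // x y /= xP yP.
have [n []] := filter_ex (filterI xP yP).
by move=> <- <-.
Qed.

Lemma backward_cvgP w : backward_cvg w ->
  forall i, \forall n \near \oo, backward n w i = backward_limit w i.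
Proof. by move=> cw i; have [v h] := cw i; rewrite (backward_limit_near h). Qed.

(** Pathwise form of invariance: the limit seen now is the limit seen [k] slots earlier, run
    forward. Convergence is assumed for the older slots only. *)
Lemma backward_limit_run k w : backward_cvg (time_shift k w) ->
  backward_cvg w /\
  backward_limit w = run (reversal k w) (backward_limit (time_shift k w)) k.
Proof.
move=> /backward_cvgP /(run_near (reversal k w) k) H.
have {}H i : \forall n \near \oo,
    backward n w i = run (reversal k w) (backward_limit (time_shift k w)) k i.
  have [m _ mH] := H i; exists (m + k)%N => // n /= mkn.
  rewrite -(subnK (leq_trans (leq_addl _ _) mkn)) backward_run.
  by apply: mH => /=; rewrite leq_subRL 1?addnC// (leq_trans (leq_addl _ _) mkn).
split; first by move=> i; eexists; exact: H.
by apply/funext => i; exact: backward_limit_near.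
Qed.

Lemma backward_bounded_cvg w i m : (forall n, (backward n w i <= m)%N) ->
  exists v, \forall n \near \oo, backward n w i = v.
Proof.
move=> bm.
have [v [[n0 vE] vmax]] : exists v, (exists n, backward n w i = v) /\
    forall n, (backward n w i <= v)%N.
  have P0 : exists v, `[< exists n, backward n w i = v >].
    by exists 0%N; apply/asboolP; exists 0%N.
  have Pm v : `[< exists n, backward n w i = v >] -> (v <= m)%N.
    by move=> /asboolP[n <-].
  case: (ex_maxnP P0 Pm) => v /asboolP h hv; exists v; split=> // n.
  by apply: hv; apply/asboolP; exists n.
exists v, n0 => // n /= n0n; apply/eqP; rewrite eqn_leq vmax -vE.
exact: (backward_homo w i).
Qed.

End backward_recursion.

(** * Measurability *)

Section measurability.
Context (R : realType) (d : nat).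

Lemma countable_bigcapT_measurable dT (T : measurableType dT) (I : countType)
    (F : I -> set T) :
  (forall i, measurable (F i)) -> measurable (\bigcap_i F i).
Proof.
move=> mF; rewrite -[X in measurable X]setCK setC_bigcap; apply: measurableC.
apply: countable_bigcupT_measurable; first exact: countableP.
by move=> i; apply: measurableC.
Qed.

Context dT (T : measurableType dT).

Lemma measurable_fun_state (f : T -> state d) :
  (forall i, measurable_fun setT (fun t => f t i)) -> measurable_fun setT f.
Proof.
move=> mf; apply: (@measurability _ _ T (state d) _ f (@coordinate_events d)) => //.
by move=> _ [_ [i [B ->]] <-]; exact: mf.
Qed.

Lemma measurable_fun_driver (f : T -> driver R d) :
  (forall e, measurable_fun setT (fun t => (f t e).1)) ->
  (forall e, measurable_fun setT (fun t => (f t e).2)) ->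
  measurable_fun setT f.
Proof.
move=> mf1 mf2; apply: (@measurability _ _ T (driver R d) _ f (@driver_cylinders R d)) => //.
move=> _ [_ [e [B [B' [mB' ->]]]] <-]; rewrite setTI.
apply: (@measurableI _ _ [set t | B (f t e).1] [set t | B' (f t e).2]).
  by rewrite -[X in measurable X]setTI; exact: mf1.
by rewrite -[X in measurable X]setTI; exact: mf2.
Qed.

Lemma measurable_fun_nat (f : T -> nat) :
  (forall n, measurable [set t | f t = n]) -> measurable_fun setT f.
Proof.
move=> mf _ B _; rewrite setTI.
rewrite (_ : f @^-1` B = \bigcup_(n in B) [set t | f t = n]); last first.
  by apply/seteqP; split => [t Bt|t [n Bn /= fn]]; [exists (f t)|rewrite /preimage/= fn].
exact: bigcup_measurable.
Qed.

Lemma measurable_set_fun (f : T -> nat) (B : set nat) :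
  measurable_fun setT f -> measurable [set t | B (f t)].
Proof. by move=> mf; rewrite -[X in measurable X]setTI; exact: mf. Qed.

(** Splitting over the countably many values of [f] freezes it, so no regularity in the integer
    argument is asked for. *)
Lemma measurable_fun_nat_param dS (S : measurableType dS) (f : T -> nat)
    (g : nat -> T -> S) : measurable_fun setT f ->
  (forall n, measurable_fun setT (g n)) ->
  measurable_fun setT (fun t => g (f t) t).
Proof.
move=> mf mg _ B mB; rewrite setTI.
rewrite [X in measurable X](_ : _ =
    \bigcup_n ([set t | f t = n] `&` g n @^-1` B)).
  apply: bigcupT_measurable => n; apply: measurableI.
    exact: (measurable_set_fun (fun m => m = n)).
  by rewrite -[X in measurable X]setTI; exact: mg.
by apply/seteqP; split => [t Bt|t [n _ /= [fn]]]; [exists (f t)|rewrite /preimage/= fn].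
Qed.

Lemma measurable_fun_nat_op dS (S : measurableType dS) (op : nat -> nat -> S)
    (f g : T -> nat) : measurable_fun setT f -> measurable_fun setT g ->
  measurable_fun setT (fun t => op (f t) (g t)).
Proof.
move=> mf mg; apply: (measurable_fun_nat_param (g := fun n t => op n (g t))) => //.
move=> n; exact: (measurable_fun_nat_param (g := fun m t => op n m)).
Qed.

Lemma measurable_fun_natr (f : T -> nat) : measurable_fun setT f ->
  measurable_fun setT (fun t => (f t)%:R : R).
Proof. 
move=> mf.
exact: (measurable_fun_nat_param (S := measurableTypeR R)
  (g := fun n _ => n%:R) mf (fun n => measurable_cst _)).
 Qed.

Lemma measurable_fun_lne (u : T -> R) : measurable_fun setT u ->
  measurable_fun setT (fun t => lne (u t)%:E : \bar R).
Proof.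
move=> mu /=; apply: measurable_fun_ifT => //.
  exact: measurable_fun_ler.
by apply/measurable_EFinP; apply: measurableT_comp => //; exact: measurable_ln.
Qed.

Lemma measurable_ltr_set (f g : T -> R) : measurable_fun setT f ->
  measurable_fun setT g -> measurable [set t | f t < g t].
Proof.
move=> mf mg; have := measurable_fun_ltr mf mg measurableT (Y := [set true]) I.
by rewrite setTI; congr (measurable _); apply/seteqP; split => t.
Qed.

Context (a : site d -> R) (ha : interference_rates a).
Variables (x : T -> state d) (u : T -> site d -> R) (xi : T -> site d -> nat).
Hypothesis mx : forall i, measurable_fun setT (fun t => x t i).
Hypothesis mu : forall i, measurable_fun setT (fun t => u t i).
Hypothesis mxi : forall i, measurable_fun setT (fun t => xi t i).

Lemma measurable_fun_tau i : measurable_fun setT (fun t => tau (x t) (u t) i : \bar R).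
Proof.
pose g n t : \bar R :=
  (if n == 0%N then +oo else (- lne (u t i)%:E) / (n%:R)%:E)%E.
apply: (measurable_fun_nat_param (g := g)) => // n; rewrite /g.
case: (n == 0%N) => //.
have [n0|n0] := eqVneq (n%:R : R) 0.
  rewrite n0 inver eqxx; apply: emeasurable_funM => //.
  by apply: measurableT_comp => //; exact: measurable_fun_lne.
rewrite inver (negbTE n0); apply: emeasurable_funM => //.
by apply: measurableT_comp => //; exact: measurable_fun_lne.
Qed.

Lemma measurable_transmits alg i :
  measurable [set t | transmits alg a (x t) (u t) i].
Proof.
have m0 : measurable [set t | (0 < x t i)%N].
  exact: (measurable_set_fun (fun n => (0 < n)%N)).
case: alg => /=; last first.
  rewrite (_ : [set t | _] = [set t | (0 < x t i)%N] `&`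
     [set t | u t i < psi a (x t) i]); last first.
    by apply/seteqP; split => [t /andP[]|t /= [-> ->]].
  apply: measurableI => //; apply: measurable_ltr_set => //.
  (* The inverse is rewritten as a power, a measurable function of its base; the two agree because
     the sum is nonnegative. *)
  under eq_fun => t.
    rewrite (psiE ha) -powR_inv1; last exact: (le_trans _ (interference_ge ha _ _)).
    over.
  apply: measurable_funM; first exact: measurable_fun_natr.
  apply: (measurableT_comp (measurable_powR _)).
  apply: measurable_sum => h; apply: measurable_funM => //.
  exact: measurable_fun_natr.
pose F j : set T := if (0 < a (j - i)) && (j != i) then
  [set t | (tau (x t) (u t) i < tau (x t) (u t) j / (a (j - i))%:E)%E] else setT.
rewrite (_ : [set t | _] = [set t | (0 < x t i)%N] `&` \bigcap_j F j); last first.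
  apply/seteqP; split => t /=.
    move=> /andP[-> /asboolP H]; split => // j _; rewrite /F.
    by case: ifPn => // /andP[? ?] /=; exact: H.
  move=> [-> H]; apply/asboolP => j aji ji.
  by have := H j I; rewrite /F aji ji.
apply: measurableI => //; apply: countable_bigcapT_measurable => j.
rewrite /F; case: ifPn => // /andP[aji _]; rewrite -[X in measurable X]setTI.
apply: measurable_lte => //; first exact: measurable_fun_tau.
rewrite inver gt_eqF//; apply: emeasurable_funM => //; exact: measurable_fun_tau.
Qed.

Lemma measurable_step alg i :
  measurable_fun setT (fun t => step alg a (xi t) (u t) (x t) i).
Proof.
apply: (measurable_fun_nat_op subn).
  exact: (measurable_fun_nat_op addn).
apply: measurable_fun_nat => -[|[|n]].
- rewrite (_ : [set t | _] = ~` [set t | transmits alg a (x t) (u t) i]).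
    by apply: measurableC; exact: measurable_transmits.
  by apply/seteqP; split => t /=; case: (transmits _ _ _).
- rewrite (_ : [set t | _] = [set t | transmits alg a (x t) (u t) i]).
    exact: measurable_transmits.
  by apply/seteqP; split => t /=; case: (transmits _ _ _).
- rewrite (_ : [set t | _] = set0) //.
  by apply/seteqP; split => t /=; case: (transmits _ _ _).
Qed.

End measurability.

Section measurability_of_the_dynamics.
Context (R : realType) (d : nat) (a : site d -> R) (ha : interference_rates a)
  (alg : service_algorithm).

Lemma measurable_coordinate i : measurable_fun setT (fun x : state d => x i).
Proof.
move=> _ B _; rewrite setTI; apply: sub_sigma_algebra.
by exists i, B.
Qed.

Lemma measurable_driver1 e : measurable_fun setT (fun w : driver R d => (w e).1).
Proof.
move=> _ B _; rewrite setTI; apply: sub_sigma_algebra.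
exists e, B, setT; split => //.
by apply/seteqP; split => w //= [].
Qed.

Lemma measurable_driver2 e : measurable_fun setT (fun w : driver R d => (w e).2).
Proof.
move=> _ B mB; rewrite setTI; apply: sub_sigma_algebra.
exists e, setT, B; split => //.
by apply/seteqP; split => w //= [].
Qed.

Lemma measurable_driver_fst dT (T : measurableType dT) (w : T -> driver R d) e :
  measurable_fun setT w -> measurable_fun setT (fun t => (w t e).1).
Proof. by move=> mw; exact: (measurableT_comp (measurable_driver1 e)). Qed.

Lemma measurable_driver_snd dT (T : measurableType dT) (w : T -> driver R d) e :
  measurable_fun setT w -> measurable_fun setT (fun t => (w t e).2).
Proof. by move=> mw; exact: (measurableT_comp (measurable_driver2 e)). Qed.

Context dT (T : measurableType dT).

Lemma measurable_queues (x : T -> state d) (xi : T -> nat -> site d -> nat)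
    (u : T -> nat -> site d -> R) k :
  measurable_fun setT x ->
  (forall l i, measurable_fun setT (fun t => xi t l i)) ->
  (forall l i, measurable_fun setT (fun t => u t l i)) ->
  measurable_fun setT (fun t => queues alg a (xi t) (u t) (x t) k).
Proof.
move=> mx mxi mu; elim: k => //= k IH.
apply: measurable_fun_state => i; apply: measurable_step => // j.
exact: (measurableT_comp (measurable_coordinate j) IH).
Qed.

Lemma measurable_service (w : T -> driver R d) k i :
  measurable_fun setT w -> measurable_fun setT (fun t => service (w t) k i).
Proof.
by move=> mw; apply: measurable_minr => //; exact: measurable_driver_snd.
Qed.

Lemma measurable_arrival (w : T -> driver R d) k i :
  measurable_fun setT w -> measurable_fun setT (fun t => arrival (w t) k i).
Proof. by move=> mw; exact: measurable_driver_fst. Qed.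

Lemma measurable_run (x : T -> state d) (w : T -> driver R d) k :
  measurable_fun setT x -> measurable_fun setT w ->
  measurable_fun setT (fun t => run a alg (w t) (x t) k).
Proof.
move=> mx mw; apply: measurable_queues => // l i.
  exact: measurable_arrival.
exact: measurable_service.
Qed.

End measurability_of_the_dynamics.

Section measurability_of_the_limit.
Context (R : realType) (d : nat) (a : site d -> R) (ha : interference_rates a)
  (alg : service_algorithm).

Lemma measurable_reversal k : measurable_fun setT (reversal (R := R) (d := d) k).
Proof.
by apply: measurable_fun_driver => e; rewrite /reversal; case: (e.1 < k)%N;
  [exact: measurable_driver1|exact: measurable_driver1
  |exact: measurable_driver2|exact: measurable_driver2].
Qed.

Lemma measurable_backward n : measurable_fun setT (backward (R := R) (d := d) a alg n).
Proof.
rewrite [X in measurable_fun _ X](_ : _ =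
    fun w => run a alg (reversal n w) (fun=> 0%N) n); last first.
  by apply/funext => w; rewrite backward_run0.
apply: measurable_run => //; exact: measurable_reversal.
Qed.

Lemma measurable_backward_coord n i :
  measurable_fun setT (fun w => backward (R := R) (d := d) a alg n w i).
Proof. exact: (measurableT_comp (measurable_coordinate i) (measurable_backward n)). Qed.

Lemma measurable_backward_cvg : measurable (backward_cvg (R := R) (d := d) a alg).
Proof.
rewrite (_ : backward_cvg _ _ = \bigcap_i \bigcup_v \bigcup_m \bigcap_n
    [set w | (m <= n)%N -> backward a alg n w i = v]).
  apply: countable_bigcapT_measurable => i; apply: bigcupT_measurable => v.
  apply: bigcupT_measurable => m; apply: bigcapT_measurable => n.
  apply: (measurable_set_fun (fun k => (m <= n)%N -> k = v)).
  exact: measurable_backward_coord.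
apply/seteqP; split => w.
  move=> cw i _; have [v [m _ H]] := cw i; exists v => //; exists m => // n _ /= mn.
  exact: H.
by move=> H i; have [v _ [m _ {}H]] := H i I; exists v, m => // n /= mn; exact: (H n).
Qed.

Lemma measurable_backward_limit :
  measurable_fun setT (backward_limit (R := R) (d := d) a alg).
Proof.
apply: measurable_fun_state => i.
pose C v : set (driver R d) := [set w | \forall n \near \oo, backward a alg n w i = v].
have mC v : measurable (C v).
  rewrite (_ : C v = \bigcup_m \bigcap_n
      [set w | (m <= n)%N -> backward a alg n w i = v]).
    apply: bigcupT_measurable => m; apply: bigcapT_measurable => n.
    apply: (measurable_set_fun (fun k => (m <= n)%N -> k = v)).
    exact: measurable_backward_coord.
  apply/seteqP; split => w.
    by move=> [m _ H]; exists m => // n _ /= mn; exact: H.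
  by move=> [m _ H]; exists m => // n /= mn; exact: (H n).
apply: measurable_fun_nat => v.
(* The second piece is the event of no limit, on which the value is the default 0. *)
rewrite (_ : [set w | _] = C v `|` ((if v == 0%N then setT else set0) `&`
    ~` \bigcup_n C n)).
  apply: measurableU => //; apply: measurableI; first by case: ifP.
  by apply: measurableC; exact: bigcupT_measurable.
apply/seteqP; split => w /=.
  have [[v' v'P] wv|nC wv] := pselect (exists v, C v w).
    by left; rewrite -wv (backward_limit_near v'P).
  right; rewrite -wv /backward_limit xgetPN ?eqxx; last by move=> n nP; apply: nC; exists n.
  by split => // -[n _ nP]; apply: nC; exists n.
move=> [/backward_limit_near //|[v0 nC]].
move: v0; case: ifP => // /eqP -> _.
by rewrite /backward_limit xgetPN// => n nP; apply: nC; exists n.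
Qed.

End measurability_of_the_limit.

(** * Independent drivers *)

Section driven.
Context (R : realType) (d : nat) (qN : set nat -> \bar R) (qR : set R -> \bar R).

(* V has the law of an independent family of pairs with marginals qN and qR. *)
Definition driven dT (T : measurableType dT) (P : probability T R)
    (V : T -> driver R d) : Prop :=
  measurable_fun setT V /\
  forall (s : seq (nat * site d)) (B : nat * site d -> set nat)
    (B' : nat * site d -> set R), uniq s -> (forall e, measurable (B' e)) ->
  P [set t | forall e, e \in s -> B e (V t e).1 /\ B' e (V t e).2] =
  (\prod_(e <- s) (qN (B e) * qR (B' e)))%E.

Definition finite_cylinders : set (set (driver R d)) :=
  [set C | exists (s : seq (nat * site d)) (B : nat * site d -> set nat)
    (B' : nat * site d -> set R), [/\ uniq s, forall e, measurable (B' e) &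
    C = [set w | forall e, e \in s -> B e (w e).1 /\ B' e (w e).2]]].

Lemma finite_cylinders_setI : setI_closed finite_cylinders.
Proof.
move=> _ _ [s [B [B' [us mB' ->]]]] [r [C [C' [ur mC' ->]]]].
exists (undup (s ++ r)).
exists (fun e => [set n | (e \in s -> B e n) /\ (e \in r -> C e n)]).
exists (fun e => [set x | (e \in s -> B' e x) /\ (e \in r -> C' e x)]).
split; first exact: undup_uniq.
  move=> e; apply: (@measurableI _ _ [set x | e \in s -> B' e x]
      [set x | e \in r -> C' e x]).
    case: (e \in s); last by rewrite [X in measurable X](_ : _ = setT)//; apply/seteqP; split.
    rewrite [X in measurable X](_ : _ = B' e)//.
    by apply/seteqP; split => x //=; apply.
  case: (e \in r); last by rewrite [X in measurable X](_ : _ = setT)//; apply/seteqP; split.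
  rewrite [X in measurable X](_ : _ = C' e)//.
  by apply/seteqP; split => x //=; apply.
apply/seteqP; split => w /=.
  by move=> [H K] e _; split; split => he; [have [] := H e he|have [] := K e he
    |have [] := H e he|have [] := K e he].
move=> H; split => e he.
  have /H[[h _] [h' _]] : e \in undup (s ++ r) by rewrite mem_undup mem_cat he.
  by split; [exact: h|exact: h'].
have /H[[_ h] [_ h']] : e \in undup (s ++ r) by rewrite mem_undup mem_cat he orbT.
by split; [exact: h|exact: h'].
Qed.

Lemma measurable_finite_cylinders :
  @measurable _ (driver R d) = <<s finite_cylinders >>.
Proof.
apply/seteqP; split.
  apply: smallest_sub; first exact: smallest_sigma_algebra.
  move=> _ [e [B [B' [mB' ->]]]]; apply: sub_sigma_algebra.
  exists [:: e], (fun=> B), (fun=> B'); split => //.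
  apply/seteqP; split => w /= => [H e'|]; first by rewrite inE => /eqP ->.
  by apply; rewrite inE.
apply: smallest_sub; first exact: smallest_sigma_algebra.
move=> _ [s [B [B' [us mB' ->]]]].
rewrite [X in _ X](_ : _ =
    \bigcap_(e in [set` s]) [set w : driver R d | B e (w e).1 /\ B' e (w e).2]).
  apply: fin_bigcap_measurable => // e _; apply: sub_sigma_algebra.
  by exists e, (B e), (B' e); split.
by apply/seteqP; split.
Qed.

(** The product formula fixes the law on finite cylinders, a generating class stable under
    intersection. The two fields may live on different spaces, which is how a field is exchanged for
    one spliced from independent copies. *)
Lemma driven_law dT1 (T1 : measurableType dT1) (P1 : probability T1 R) V1
    dT2 (T2 : measurableType dT2) (P2 : probability T2 R) V2 A :
  driven P1 V1 -> driven P2 V2 -> measurable A ->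
  P1 (V1 @^-1` A) = P2 (V2 @^-1` A).
Proof.
move=> [mV1 V1P] [mV2 V2P] mA.
pose W1 : {mfun T1 >-> driver R d} := HB.pack V1 (isMeasurableFun.Build _ _ _ _ _ mV1).
pose W2 : {mfun T2 >-> driver R d} := HB.pack V2 (isMeasurableFun.Build _ _ _ _ _ mV2).
have := @measure_unique _ R (driver R d) finite_cylinders (fun=> setT)
  measurable_finite_cylinders finite_cylinders_setI _ _
  (distribution P1 W1) (distribution P2 W2) _ _ A mA; apply.
- move=> _; exists [::], (fun=> setT), (fun=> setT); split => //.
  by apply/seteqP; split.
- by apply/seteqP; split => // w _; exists 0%N.
- move=> _ [s [B [B' [us mB' ->]]]].
  transitivity (\prod_(e <- s) (qN (B e) * qR (B' e)))%E.
    exact: V1P.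
  by apply/esym; exact: V2P.
- move=> k; apply: (le_lt_trans (probability_le1 (distribution P1 W1) measurableT)).
  exact: ltry.
Qed.

Lemma driven_integral dT1 (T1 : measurableType dT1) (P1 : probability T1 R) V1
    dT2 (T2 : measurableType dT2) (P2 : probability T2 R) V2 (f : driver R d -> \bar R) :
  driven P1 V1 -> driven P2 V2 -> measurable_fun setT f ->
  (forall w, (0 <= f w)%E) ->
  (\int[P1]_t f (V1 t) = \int[P2]_t f (V2 t))%E.
Proof.
move=> D1 D2 mf f0; have [mV1 _] := D1; have [mV2 _] := D2.
pose W1 : {mfun T1 >-> driver R d} := HB.pack V1 (isMeasurableFun.Build _ _ _ _ _ mV1).
pose W2 : {mfun T2 >-> driver R d} := HB.pack V2 (isMeasurableFun.Build _ _ _ _ _ mV2).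
transitivity (\int[distribution P1 W1]_w f w)%E.
  by rewrite ge0_integral_distribution.
transitivity (\int[distribution P2 W2]_w f w)%E.
  by apply: eq_measure_integral => A mA _; exact: (driven_law D1 D2 mA).
by rewrite ge0_integral_distribution.
Qed.

Lemma driven_image dT (T : measurableType dT) (P : probability T R) V
    (s : seq (nat * site d)) (sigma : nat * site d -> nat * site d)
    (B : nat * site d -> set nat) (B' : nat * site d -> set R) :
  driven P V -> uniq s -> {in s &, injective sigma} ->
  (forall e, measurable (B' e)) ->
  P [set t | forall e, e \in s -> B e (V t (sigma e)).1 /\ B' e (V t (sigma e)).2] =
  (\prod_(e <- s) (qN (B e) * qR (B' e)))%E.
Proof.
move=> [mV VP] us inj mB'.
(* Constraints are transported along [sigma]. Injectivity on [s] leaves a single constraint over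
   each image point, as [CE] and [CE'] record. *)
pose C f : set nat := [set n | forall e, e \in s -> sigma e = f -> B e n].
pose C' f : set R := [set x | forall e, e \in s -> sigma e = f -> B' e x].
have mC' f : measurable (C' f).
  rewrite (_ : C' f = \bigcap_(e in [set e | e \in s /\ sigma e = f]) B' e).
    apply: fin_bigcap_measurable => //.
    by apply: (@sub_finite_set _ _ [set` s]) => // e [].
  by apply/seteqP; split => x; [move=> H e [es ef]; exact: H
    |move=> H e es ef; exact: (H e)].
have CE e : e \in s -> C (sigma e) = B e.
  move=> es; apply/seteqP; split => n; first exact.
  by move=> Bn f fs /(inj _ _ fs es) ->.
have CE' e : e \in s -> C' (sigma e) = B' e.
  move=> es; apply/seteqP; split => n; first exact.
  by move=> Bn f fs /(inj _ _ fs es) ->.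
transitivity (\prod_(e <- map sigma s) (qN (C e) * qR (C' e)))%E; last first.
  by rewrite big_map; apply: eq_big_seq => e es; rewrite CE// CE'.
rewrite -VP//; last by rewrite map_inj_in_uniq.
congr (P _); apply/seteqP; split => t /=.
  by move=> H _ /mapP[e es ->]; rewrite CE// CE'//; exact: H.
by move=> H e es; rewrite -(CE e)// -(CE' e)//; apply: H; exact: map_f.
Qed.

Lemma driven_reindex dT (T : measurableType dT) (P : probability T R) V
    (sigma : nat * site d -> nat * site d) :
  driven P V -> injective sigma -> driven P (fun t e => V t (sigma e)).
Proof.
move=> VP inj; have [mV _] := VP; split.
  by apply: measurable_fun_driver => e;
    [exact: measurable_driver_fst|exact: measurable_driver_snd].
by move=> s B B' us mB'; apply: driven_image => // e f _ _; exact: inj.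
Qed.

(** Disjoint blocks of an independent field may be taken from separate copies without changing the
    law. This replaces conditioning throughout, and injectivity is asked on each block separately
    because the copies do not interact. *)
Lemma driven_splice dT1 (T1 : measurableType dT1) (P1 : probability T1 R) V1
    dT2 (T2 : measurableType dT2) (P2 : probability T2 R) V2
    (b : pred (nat * site d)) (sigma1 sigma2 : nat * site d -> nat * site d) :
  driven P1 V1 -> driven P2 V2 ->
  {in b &, injective sigma1} -> {in predC b &, injective sigma2} ->
  driven (P1 \x P2)%E (fun z e => if b e then V1 z.1 (sigma1 e) else V2 z.2 (sigma2 e)).
Proof.
move=> V1P V2P inj1 inj2; have [mV1 _] := V1P; have [mV2 _] := V2P; split.
  apply: measurable_fun_driver => e; case: (b e).
  - exact: (measurable_driver_fst (w := V1 \o fst) _ (measurableT_comp mV1 measurable_fst)).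
  - exact: (measurable_driver_fst (w := V2 \o snd) _ (measurableT_comp mV2 measurable_snd)).
  - exact: (measurable_driver_snd (w := V1 \o fst) _ (measurableT_comp mV1 measurable_fst)).
  - exact: (measurable_driver_snd (w := V2 \o snd) _ (measurableT_comp mV2 measurable_snd)).
move=> s B B' us mB'.
pose S1 := [set t | forall e, e \in [seq f <- s | b f] ->
  B e (V1 t (sigma1 e)).1 /\ B' e (V1 t (sigma1 e)).2].
pose S2 := [set t | forall e, e \in [seq f <- s | ~~ b f] ->
  B e (V2 t (sigma2 e)).1 /\ B' e (V2 t (sigma2 e)).2].
have S1E : P1 S1 = (\prod_(e <- [seq f <- s | b f]) (qN (B e) * qR (B' e)))%E.
  apply: driven_image => //; first exact: filter_uniq.
  by move=> e f; rewrite !mem_filter => /andP[be _] /andP[bf _]; exact: inj1.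
have S2E : P2 S2 = (\prod_(e <- [seq f <- s | ~~ b f]) (qN (B e) * qR (B' e)))%E.
  apply: driven_image => //; first exact: filter_uniq.
  by move=> e f; rewrite !mem_filter => /andP[be _] /andP[bf _]; exact: inj2.
have mS1 : measurable S1.
  rewrite (_ : S1 = \bigcap_(e in [set` [seq f <- s | b f]])
    ([set t | B e (V1 t (sigma1 e)).1] `&` [set t | B' e (V1 t (sigma1 e)).2])).
    apply: fin_bigcap_measurable => // e _; apply: measurableI.
      by apply: measurable_set_fun; exact: measurable_driver_fst.
    rewrite -[X in measurable X]setTI.
    exact: (measurable_driver_snd (sigma1 e) mV1).
  by apply/seteqP; split.
have mS2 : measurable S2.
  rewrite (_ : S2 = \bigcap_(e in [set` [seq f <- s | ~~ b f]])
    ([set t | B e (V2 t (sigma2 e)).1] `&` [set t | B' e (V2 t (sigma2 e)).2])).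
    apply: fin_bigcap_measurable => // e _; apply: measurableI.
      by apply: measurable_set_fun; exact: measurable_driver_fst.
    rewrite -[X in measurable X]setTI.
    exact: (measurable_driver_snd (sigma2 e) mV2).
  by apply/seteqP; split.
rewrite (_ : [set t | _] = S1 `*` S2); last first.
  apply/seteqP; split => -[t1 t2] /=.
    move=> H; split => e; rewrite mem_filter => /andP[be es]; have := H e es.
      by rewrite be.
    by rewrite -[b e]negbK be.
  move=> [H1 H2] e es; case: ifPn => be.
    by apply: H1; rewrite mem_filter be.
  by apply: H2; rewrite mem_filter /= be.
transitivity (P1 S1 * P2 S2)%E; first exact: product_measure1E.
rewrite S1E S2E !big_filter.
by rewrite [RHS](bigID b).
Qed.

End driven.

(** * Stochastic domination *)

Section regularity.
Context (R : realType) (d : nat).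
Implicit Types (A C V : set (state d)) (s : seq (site d)).

(* Closedness for the product of the discrete topologies. *)
Definition closed_config C :=
  forall x, (forall s, exists2 c, C c & {in s, forall i, c i = x i}) -> C x.

Lemma closed_configU C C' :
  closed_config C -> closed_config C' -> closed_config (C `|` C').
Proof.
move=> cC cC' x H; apply: contrapT => /= /not_orP[nC nC'].
have [s sP] : exists s, forall c, C c -> ~ {in s, forall i, c i = x i}.
  apply: contrapT => /forallNP h; apply: nC; apply: cC => s.
  by have /existsNP[c /not_implyP[Cc /contrapT ?]] := h s; exists c.
have [s' sP'] : exists s, forall c, C' c -> ~ {in s, forall i, c i = x i}.
  apply: contrapT => /forallNP h; apply: nC'; apply: cC' => s'.
  by have /existsNP[c /not_implyP[Cc /contrapT ?]] := h s'; exists c.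
have [c [/sP|/sP'] h cx] := H (s ++ s'); apply: h => i is_;
  by apply: cx; rewrite mem_cat is_ ?orbT.
Qed.

Lemma closed_config_bigcap (F : (set (state d))^nat) :
  (forall k, closed_config (F k)) -> closed_config (\bigcap_n F n).
Proof.
move=> cF x H n _; apply: cF => s; have [c Fc cx] := H s.
by exists c => //; exact: Fc.
Qed.

Lemma closed_config_coordinate i (B : set nat) :
  closed_config [set x | B (x i)].
Proof.
by move=> x /(_ [:: i])[c /= Bc cx]; rewrite -cx// inE.
Qed.

Lemma closed_config0 : closed_config set0.
Proof. by move=> x /(_ [::])[]. Qed.

(** Inner closed and outer open approximations are required together, since complementation
    exchanges them. *)
Definition regular_set (mu : probability (state d) R) A :=
  measurable A /\ forall e : R, 0 < e -> exists C V,
    [/\ measurable C, measurable V, closed_config C, closed_config (~` V) &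
      [/\ C `<=` A, A `<=` V & (mu (V `\` C) <= e%:E)%E]].

Lemma closed_config_bigsetU (F : (set (state d))^nat) n :
  (forall k, closed_config (F k)) -> closed_config (\big[setU/set0]_(i < n) F i).
Proof.
move=> cF; elim: n => [|n IH]; first by rewrite big_ord0; exact: closed_config0.
by rewrite big_ord_recr; exact: closed_configU.
Qed.

(** The regular sets form a sigma-algebra, and it contains the coordinate events because these are
    both open and closed. *)
Lemma regular_measurable (mu : probability (state d) R) A :
  measurable A -> regular_set mu A.
Proof.
move=> mA; pose G : set (set (state d)) := regular_set mu.
suff GS : <<s @coordinate_events d >> `<=` G by exact: GS.
apply: smallest_sub; last first.
  move=> _ [i [B ->]]; have mB : measurable [set x : state d | B (x i)].
    by apply: sub_sigma_algebra; exists i, B.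
  split=> // e e0; exists [set x | B (x i)], [set x | B (x i)]; split => //.
  - exact: closed_config_coordinate.
  - exact: (closed_config_coordinate (B := ~` B)).
  - by split => //; rewrite setDv measure0 lee_fin ltW.
split.
- split => // e e0; exists set0, set0; split => //.
  + exact: closed_config0.
  + by rewrite setC0.
  + by split => //; rewrite setDv measure0 lee_fin ltW.
- move=> B [mB rB]; rewrite setTD; split; first exact: measurableC.
  move=> e e0; have [C [V [mC mO cC cO [CB BO h]]]] := rB _ e0.
  exists (~` V), (~` C); split; rewrite ?setCK//; try exact: measurableC.
  split; rewrite ?subsetC//; first by move=> x /= + Bx; apply; exact: BO.
    by move=> x /= + Cx; apply; exact: CB.
  by rewrite setDE setCK setIC -setDE.
- move=> F rF; split; first by apply: bigcupT_measurable => n; have [] := rF n.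
  move=> e e0.
  (* These errors add up to at most [e / 2]. The remaining slack pays for replacing the union of all
     the inner closed sets, which need not be closed, by a finite union. *)
  have e20 n : 0 < e / 2 / (2 ^ n.+1)%:R by rewrite !divr_gt0// ltr0n expn_gt0.
  have /choice[CO COP] : forall n, exists CO : set (state d) * set (state d),
    [/\ measurable CO.1, measurable CO.2, closed_config CO.1, closed_config (~` CO.2) &
      [/\ CO.1 `<=` F n, F n `<=` CO.2 &
        (mu (CO.2 `\` CO.1) <= (e / 2 / (2 ^ n.+1)%:R)%:E)%E]].
    by move=> n; have [_ /(_ _ (e20 n))[C [V h]]] := rF n; exists (C, V).
  have UE n : \big[setU/set0]_(i < n) (CO i).1 = \bigcup_(i < n) (CO i).1.
    by rewrite -(bigcup_mkord n (fun i => (CO i).1)).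
  pose V := \bigcup_n (CO n).2; pose D n := V `\` \big[setU/set0]_(i < n) (CO i).1.
  have mO : measurable V by apply: bigcupT_measurable => n; have [] := COP n.
  have mC n : measurable (\big[setU/set0]_(i < n) (CO i).1).
    by apply: bigsetU_measurable => i _; have [] := COP i.
  have mD n : measurable (D n) by exact: measurableD.
  have DE : \bigcap_n D n = V `\` \bigcup_n (CO n).1.
    apply/seteqP; split => x.
      move=> H; split; first by have [] := H 0%N I.
      move=> [n _ Cn]; have [_] := H n.+1 I; apply.
      by rewrite UE; exists n => /=.
    move=> [Ox nC] n _; split => //; rewrite UE => -[m _ Cm].
    by apply: nC; exists m.
  have mDc : measurable (\bigcap_n D n) by exact: bigcapT_measurable.
  have cvgD : (mu \o D) n @[n --> \oo] --> mu (\bigcap_n D n).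
    apply: nonincreasing_cvg_mu => //.
      by apply: (le_lt_trans (probability_le1 mu (mD 0%N))); exact: ltry.
    move=> m n mn; apply/subsetPset; apply: setDS.
    by rewrite !UE; apply: bigcup_sub => k /= km x Ckx; exists k => //=;
      exact: leq_trans mn.
  have Dlt : (mu (\bigcap_n D n) < e%:E)%E.
    apply: (@le_lt_trans _ _ (e / 2)%:E); last by rewrite lte_fin ltr_pdivrMr// ltr_pMr// ltr1n.
    apply: (@le_trans _ _ (\sum_(n <oo) mu ((CO n).2 `\` (CO n).1))%E).
      apply: measure_sigma_subadditive => //.
        by move=> n; apply: measurableD; have [] := COP n.
      rewrite DE => x [[n _ Ox] nC]; exists n => //; split => //.
      by move=> Cx; apply: nC; exists n.
    apply: (le_trans _ (@epsilon_trick0 R (e / 2) xpredT _)); last by rewrite divr_ge0// ltW.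
    by apply: lee_nneseries => // n _; have [_ _ _ _ []] := COP n.
  have [n Dn] : exists n, (mu (D n) < e%:E)%E.
    apply: contrapT => /forallNP H.
    have : (e%:E <= mu (\bigcap_n D n))%E.
      rewrite -(cvg_lim (@ereal_hausdorff R) cvgD).
  apply: lime_ge; first by apply/cvg_ex; eexists; exact: cvgD.
  near=> n => /=.
      by rewrite leNgt; apply/negP; exact: H.
    by rewrite leNgt Dlt.
  exists (\big[setU/set0]_(i < n) (CO i).1), V; split => //.
  + by apply: (closed_config_bigsetU (F := fun m => (CO m).1)) => m; have [] := COP m.
  + by rewrite setC_bigcup; apply: (closed_config_bigcap (F := fun m => ~` (CO m).2)) => m; have [] := COP m.
  + split; last exact: ltW.
      by rewrite UE => x [m _ Cm]; exists m => //; have [_ _ _ _ [h _ _]] := COP m; exact: h.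
    by move=> x [m _ Fm]; exists m => //; have [_ _ _ _ [_ h _]] := COP m; exact: h.
Unshelve. all: by end_near. Qed.

(** Only countably many lists of values can occur on [s], and each determines membership in [A]. *)
Lemma measurable_finite_support s A :
  (forall x y, {in s, forall i, x i = y i} -> A x -> A y) -> measurable A.
Proof.
move=> sA.
pose F (t : seq nat) := [set x : state d |
  exists c, [/\ A c, map c s = t & {in s, forall i, x i = c i}]].
rewrite (_ : A = \bigcup_t F t); last first.
  apply/seteqP; split => x; first by move=> Ax; exists (map x s) => //; exists x.
  move=> [t _ [c [Ac _ xc]]]; apply: sA Ac => i si; by rewrite xc.
apply: countable_bigcupT_measurable; first exact: countableP.
move=> t; have [[c [Ac ct]]|nc] := pselect (exists c, A c /\ map c s = t); last first.
  rewrite (_ : F t = set0) //; apply/seteqP; split => // x [c [Ac ct _]].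
  by apply: nc; exists c.
rewrite (_ : F t = \bigcap_(i in [set` s]) [set x | x i = c i]).
  apply: fin_bigcap_measurable => // i _.
  by apply: sub_sigma_algebra; exists i, [set c i].
apply/seteqP; split => x.
  move=> [c' [_ c't xc']] i /= si; rewrite xc'//.
  by move: c't; rewrite -ct => /eq_in_map; apply.
by move=> H; exists c; split.
Qed.

(* Compactness: limits along an ultrafilter exist because the coordinates stay
   below those of x. *)
Lemma closed_config_up C x : closed_config C ->
  (forall s, exists2 c, C c & {in s, forall i, (c i <= x i)%N}) ->
  exists2 c, C c & forall i, (c i <= x i)%N.
Proof.
move=> cC H.
pose B s := [set c : state d | C c /\ {in s, forall i, (c i <= x i)%N}].
have FF : Filter (filter_from setT B).
  apply: filter_from_filter; first by exists [::].
  move=> s s' _ _; exists (s ++ s') => // c [Cc cx]; split; split => // i is_;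
    by apply: cx; rewrite mem_cat is_ ?orbT.
have PF : ProperFilter (filter_from setT B).
  by apply: filter_from_proper => s _; have [c Cc cx] := H s; exists c.
have [G [GU FG]] := ultraFilterLemma PF.
have [c cP] : exists c : state d,
    forall i, G [set y | y i = c i] /\ (c i <= x i)%N.
  suff /choice[c cP] : forall i, exists v,
      G [set y : state d | y i = v] /\ (v <= x i)%N by exists c.
  move=> i.
  have : G [set y : state d | (y i <= x i)%N].
    apply: FG; exists [:: i] => // y [_]; apply; exact: mem_head.
  elim: (x i) => [|n IH] Gn.
    by exists 0%N; split=> //; apply: filterS Gn => y /=; rewrite leqn0 => /eqP.
  have [Gv|Gv] := in_ultra_setVsetC [set y : state d | y i = n.+1] GU.
    by exists n.+1.
  have [|v [Gv' vn]] := IH.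
    apply: filterS (filterI Gn Gv) => y /= [yn ynn].
    by rewrite -ltnS ltn_neqAle yn andbT; exact/eqP.
  by exists v; split => //; exact: leqW.
exists c; last by move=> i; have [] := cP i.
apply: cC => s.
have Gs : G [set y : state d | {in s, forall i, y i = c i}].
  elim: s => [|i s IH]; first by apply: filterS filterT => y _ i.
  apply: filterS (filterI IH (cP i).1) => y /= [h yi] j.
  by rewrite inE => /predU1P[->//|]; exact: h.
have GC : G C by apply: FG; exists [::] => // y [].
by have [y [ys Cy]] := filter_ex (filterI Gs GC); exists y.
Qed.

Definition first_sites (n : nat) : seq (site d) :=
  pmap (@choice.unpickle (site d)) (iota 0 n).

Lemma sub_first_sites s : exists n, {subset s <= first_sites n}.
Proof.
exists (\max_(i <- s) choice.pickle i).+1 => i si.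
rewrite mem_pmap; apply/mapP; exists (choice.pickle i).
  by rewrite mem_iota/= add0n ltnS; apply: leq_bigmax_seq.
by rewrite choice.pickleK.
Qed.

Lemma first_sites_homo m n : (m <= n)%N -> {subset first_sites m <= first_sites n}.
Proof.
move=> mn i; rewrite !mem_pmap => /mapP[k]; rewrite mem_iota/= add0n => km ik.
by apply/mapP; exists k; rewrite // mem_iota/= add0n (leq_trans km).
Qed.

Lemma upset_le (mu nu : probability (state d) R) :
  (forall s A, (forall x y, {in s, forall i, (x i <= y i)%N} -> A x -> A y) ->
    (mu A <= nu A)%E) ->
  forall A, measurable A ->
    (forall x y, (forall i, (x i <= y i)%N) -> A x -> A y) -> (mu A <= nu A)%E.
Proof.
move=> H A mA uA; apply/lee_addgt0Pr => e e0.
have [_ /(_ _ e0)[C [V [mC mO cC _ [CA AO OC]]]]] := regular_measurable mu mA.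
pose D n := [set x : state d |
  exists2 c, C c & {in first_sites n, forall i, (c i <= x i)%N}].
have uD n x y : {in first_sites n, forall i, (x i <= y i)%N} -> D n x -> D n y.
  move=> xy [c Cc cx]; exists c => // i si.
  by rewrite (leq_trans (cx _ si))// xy.
have mD n : measurable (D n).
  apply: (measurable_finite_support (s := first_sites n)) => x y xy; apply: uD.
  by move=> i si; rewrite xy.
have CD : C `<=` \bigcap_n D n by move=> c Cc n _; exists c.
(* A point of the intersection lies above some element of [C] on every finite window; compactness
   provides one element of [C] below it at all sites. *)
have DA : \bigcap_n D n `<=` A.
  move=> x Dx; have [s|c Cc cx] := @closed_config_up C x cC.
    have [n sn] := sub_first_sites s; have [c Cc cx] := Dx n I.
    by exists c => // i /sn; exact: cx.
  by apply: uA cx _; exact: CA.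
have mDc : measurable (\bigcap_n D n) by exact: bigcapT_measurable.
have Dle : (mu (\bigcap_n D n) <= nu (\bigcap_n D n))%E.
  have cvgD : (nu \o D) n @[n --> \oo] --> nu (\bigcap_n D n).
    apply: nonincreasing_cvg_mu => //.
      by apply: (le_lt_trans (probability_le1 nu (mD 0%N))); exact: ltry.
    move=> m n mn; apply/subsetPset => x [c Cc cx]; exists c => // i si.
    by apply: cx; exact: first_sites_homo si.
  rewrite -(cvg_lim (@ereal_hausdorff R) cvgD).
  apply: lime_ge; first by apply/cvg_ex; eexists; exact: cvgD.
  near=> n => /=.
  apply: (@le_trans _ _ (mu (D n))); last exact: (H _ _ (uD n)).
  by apply: le_measure; [exact: mem_set|exact: mem_set|move=> x; apply].
apply: (@le_trans _ _ (mu (C `|` (V `\` C)))).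
  apply: le_measure; [exact: mem_set| |].
    by apply: mem_set; apply: measurableU => //; exact: measurableD.
  by move=> x /AO Ox; have [Cx|nC] := pselect (C x); [left|right].
apply: (@le_trans _ _ (mu C + mu (V `\` C))%E).
  by apply: measureU2 => //; exact: measurableD.
apply: leeD => //; apply: (@le_trans _ _ (mu (\bigcap_n D n))).
  by apply: le_measure => //; exact: mem_set.
by apply: (le_trans Dle); apply: le_measure => //; exact: mem_set.
Unshelve. all: by end_near. Qed.

(** Layer-cake formula: adding the bound [M] makes the test function nonnegative, its integral is
    that of its tail probabilities, and its superlevel sets are increasing. *)
Lemma dominatedP (mu nu : probability (state d) R) :
  (forall s A, (forall x y, {in s, forall i, (x i <= y i)%N} -> A x -> A y) ->
    (mu A <= nu A)%E) -> dominated mu nu.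
Proof.
move=> /upset_le H f mf [M fM] fmono.
pose g := (f \+ cst M)%R.
have mg : measurable_fun setT g by apply: measurable_funD.
have g0 x : 0 <= g x.
  by rewrite /g/= -lerBlDr sub0r; have := fM x; rewrite ler_norml => /andP[].
have gE (P : probability (state d) R) :
    (\int[P]_x (g x)%:E = \int[P]_x (f x)%:E + M%:E)%E.
  under eq_integral do rewrite EFinD.
  rewrite integralD//.
  - by congr (_ + _)%E; rewrite -[RHS]mule1 -(probability_setT P) -integral_cst.
  - apply: measurable_bounded_integrable => //.
      by apply: (le_lt_trans (probability_le1 P measurableT)); exact: ltry.
    exists M; split; first exact: num_real.
    by move=> m Mm x _ /=; exact: (le_trans (fM x) (ltW Mm)).
  - apply: measurable_bounded_integrable => //.
      by apply: (le_lt_trans (probability_le1 P measurableT)); exact: ltry.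
    exists `|M|; split; first exact: num_real.
    by move=> m Mm x _ /=; exact: ltW.
suff : (\int[mu]_x (g x)%:E <= \int[nu]_x (g x)%:E)%E by rewrite !gE leeD2rE.
pose X1 : {RV mu >-> R} := HB.pack g (isMeasurableFun.Build _ _ _ _ _ mg).
pose X2 : {RV nu >-> R} := HB.pack g (isMeasurableFun.Build _ _ _ _ _ mg).
have -> : (\int[mu]_x (g x)%:E = 'E_mu[X1])%E by rewrite unlock.
have -> : (\int[nu]_x (g x)%:E = 'E_nu[X2])%E by rewrite unlock.
rewrite !ge0_expectation_ccdf//.
apply: ge0_le_integral => //.
- by apply: measurable_funTS; exact: ccdf_measurable.
- by apply: measurable_funTS; exact: ccdf_measurable.
- move=> r _; apply: H.
    by rewrite -[X in measurable X]setTI; exact: (mg measurableT _ (measurable_itv _)).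
  move=> x y xy; rewrite /= !in_itv/= !andbT => /lt_le_trans; apply.
  by rewrite lerD2r fmono.
Qed.

End regularity.

(** * Transmission probabilities *)

Section uniform.
Context (R : realType).
Local Notation unif := (uniform_prob (@ltr01 R)).

Lemma uniform_itvoo (c : R) : 0 <= c <= 1 -> unif `]0, c[%classic = c%:E.
Proof.
move=> /andP[c0 c1]; rewrite /uniform_prob.
rewrite (eq_integral (fun=> 1%:E)); last first.
  move=> x; rewrite inE/= in_itv/= /uniform_pdf => /andP[x0 xc].
  by rewrite (ltW x0) (le_trans (ltW xc) c1)/= subr0 invr1.
rewrite integral_cst//= mul1e lebesgue_measure_itv/= lte_fin.
by case: ltP => [|c0']; rewrite ?sube0//; congr (_%:E); apply/le_anti/andP.
Qed.

Lemma derivable_powR01 (r : R) : 0 < r ->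
  derivable_oo_LRcontinuous (fun x : R => x `^ r) 0 1.
Proof.
move=> r0; split.
- by move=> x /[!in_itv]/= /andP[x0 _]; apply: derivable_powR; rewrite in_itv/= x0.
- by rewrite powR0 ?gt_eqF//; exact: powR_cvg0.
- apply: cvg_at_left_filter.
  have : derivable (fun x : R => x `^ r) 1 1.
    by apply: derivable_powR; rewrite in_itv/= ltr01.
  by move=> /derivable1_diffP /differentiable_continuous.
Qed.

Lemma integral_powR01 (r : R) : 0 <= r ->
  (\int[lebesgue_measure]_(x in `[0%R, 1%R]) (x `^ r)%:E = (1 + r)^-1%:E)%E.
Proof.
move=> r0; have r1 : 0 < 1 + r by rewrite ltr_pwDl.
rewrite (@continuous_FTC2 _ _ (fun x => (1 + r)^-1 * x `^ (1 + r)))//.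
- by rewrite powR1 powR0 ?gt_eqF// mulr1 mulr0 sube0.
(* The exponent 0 is treated apart: the power tends to 0 at the left endpoint only for positive
   exponents. *)
- move: r0; rewrite le_eqVlt => /predU1P[<-|r0].
    under [X in {within _, continuous X}]eq_fun do rewrite powRr0.
    by apply: continuous_subspaceT => x; exact: cvg_cst.
  exact: (derivable_oo_LRcontinuous_within (derivable_powR01 r0)).
- have [h1 h2 h3] := derivable_powR01 r1; split.
  + by move=> x x01; apply: derivableM => //; exact: h1.
  + by apply: cvgM => //; exact: cvg_cst.
  + by apply: cvgM => //; exact: cvg_cst.
- move=> x /[!in_itv]/= /andP[x0 _].
  rewrite derive1E deriveZ/=; last by apply: derivable_powR; rewrite in_itv/= x0.
  have [_ ->] := is_derive1_powR (1 + r) x0.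
  by rewrite /GRing.scale/= mulrA mulVf ?gt_eqF// mul1r addrAC subrr add0r.
Qed.

(** Given its own variable [x], a node beats all its rivals with probability at least [x] to the sum
    of the race exponents; this lemma averages over [x]. *)
Lemma uniform_powR (r : R) : 0 <= r ->
  (\int[unif]_x (if (0 < x < 1)%R then x `^ r else 0)%:E = (1 + r)^-1%:E)%E.
Proof.
move=> r0; set f := fun x : R => if (0 < x < 1)%R then x `^ r else 0.
have mf : measurable_fun setT f.
  apply: measurable_fun_ifT => //.
  apply: measurable_and.
    exact: (measurable_fun_ltr (measurable_cst (0 : R)) (@measurable_id _ _ setT)).
  exact: (measurable_fun_ltr (@measurable_id _ _ setT) (measurable_cst (1 : R))).
rewrite (integral_uniform _ (f := EFin \o f)); last 2 first.
- exact/measurable_EFinP.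
- by move=> x; rewrite /f/=; case: ifP => _; rewrite lee_fin ?powR_ge0.
rewrite subr0 invr1 mul1e -integral_powR01//.
rewrite [LHS]integral_itv_bndoo; last by apply/measurable_EFinP/measurable_funTS.
rewrite [RHS]integral_itv_bndoo; last first.
  by apply/measurable_EFinP/measurable_funTS; exact: measurable_powR.
by apply: eq_integral => x; rewrite inE/= in_itv/= /f/= => ->.
Qed.

End uniform.

Section transmission_probability.
Context (R : realType) (d : nat) (a : site d -> R) (ha : interference_rates a)
  (alg : service_algorithm) (qN : set nat -> \bar R).
Hypothesis qN1 : qN setT = 1%E.
Local Notation unif := (uniform_prob (@ltr01 R)).

Lemma driven_service dT (T : measurableType dT) (P : probability T R) (V : T -> driver R d)
    (s : seq (nat * site d)) (B : nat * site d -> set R) :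
  driven qN unif P V -> uniq s -> (forall e, measurable (B e)) ->
  P [set t | forall e, e \in s -> B e (V t e).2] = (\prod_(e <- s) unif (B e))%E.
Proof.
move=> [mV VP] us mB.
transitivity (P [set t | forall e, e \in s -> setT (V t e).1 /\ B e (V t e).2]).
  congr (P _); apply/seteqP; split => t H e es; first by split => //; exact: H.
  by have [] := H e es.
rewrite (VP s (fun=> setT) B us mB); apply: eq_bigr => e _.
by rewrite qN1 mul1e.
Qed.

Lemma driven_service1 dT (T : measurableType dT) (P : probability T R) (V : T -> driver R d) e
    (B : set R) :
  driven qN unif P V -> measurable B -> P [set t | B (V t e).2] = unif B.
Proof.
move=> VP mB.
transitivity (\prod_(f <- [:: e]) unif B)%E; last by rewrite big_seq1.
rewrite -(driven_service (B := fun=> B) VP)//; congr (P _).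
apply/seteqP; split => t /= H; first by move=> f; rewrite inE => /eqP ->.
by apply: H; rewrite inE.
Qed.

Lemma driven_service_integral dT (T : measurableType dT) (P : probability T R) (V : T -> driver R d) e
    (f : R -> \bar R) :
  driven qN unif P V -> measurable_fun setT f -> (forall x, 0 <= f x)%E ->
  (\int[P]_t f (V t e).2 = \int[unif]_x f x)%E.
Proof.
move=> VP mf f0; have [mV _] := VP.
have mU : measurable_fun setT (fun t => (V t e).2) by exact: measurable_driver_snd.
have {}mU : @measurable_fun _ _ T (measurableTypeR R) setT (fun t => (V t e).2).
  exact: mU.
pose W : {mfun T >-> measurableTypeR R} := HB.pack (fun t => (V t e).2)
  (isMeasurableFun.Build _ _ _ _ _ mU).
transitivity (\int[distribution P W]_x f x)%E.
  by rewrite ge0_integral_distribution.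
by apply: eq_measure_integral => A mA _; exact: (driven_service1 e VP mA).
Qed.

(* In terms of uniform variables, tau_i < tau_(i+h) / a_h reads
   u_(i+h) < u_i ^ r_h with r_h = a_h x_(i+h) / x_i. *)
Definition race_exponent (x : state d) (i h : site d) : R :=
  a h * (x (i + h))%:R / (x i)%:R.

Lemma race_exponent_ge0 x i h : 0 <= race_exponent x i h.
Proof. by rewrite /race_exponent divr_ge0// mulr_ge0// rate_ge0. Qed.

Lemma powR_le1 (v r : R) : 0 < v <= 1 -> 0 <= r -> v `^ r <= 1.
Proof. by move=> v01 r0; rewrite -[leRHS](powRr0 v) ger_powR. Qed.

(** The strict bounds keep all logarithms finite and negative, so the comparison of clocks becomes
    one of real numbers; a rival with an empty queue has an infinite clock. *)
Lemma race_transmits (x : state d) (u : site d -> R) i : (0 < x i)%N ->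
  0 < u i < 1 ->
  (forall h, h \in neighbours ha -> h != 0 ->
    0 < u (i + h) < u i `^ race_exponent x i h) ->
  transmits D1 a x (fun j => Num.min (u j) 1) i.
Proof.
move=> xi0 /andP[ui0 ui1] H; rewrite /= xi0/=; apply/asboolP => j aji ji.
have := H (j - i); rewrite mem_neighbours aji subr_eq0 addrC subrK => /(_ isT ji).
move=> /andP[uj0 ujr].
have uj1 : u j < 1.
  by rewrite (lt_le_trans ujr)// powR_le1 ?race_exponent_ge0// ui0 ltW.
rewrite /tau (min_l (ltW ui1)) (min_l (ltW uj1)) !lne_EFin//.
have xi0' : 0 < (x i)%:R :> R by rewrite ltr0n.
rewrite (gtn_eqF xi0) !inver (gt_eqF xi0') (gt_eqF aji) -EFinN -EFinM.
case: ifPn => [_|xj0].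
  by rewrite gt0_mulye ?ltry// lte_fin invr_gt0.
have xj0' : 0 < (x j)%:R :> R by rewrite ltr0n lt0n.
rewrite (gt_eqF xj0') -EFinN -!EFinM lte_fin.
have : ln (u j) < race_exponent x i (j - i) * ln (u i).
  by rewrite -ln_powR ltr_ln ?posrE// powR_gt0.
rewrite /race_exponent [i + _]addrC subrK => h.
rewrite ltr_pdivlMr// ltr_pdivlMr//.
suff -> : - ln (u i) / (x i)%:R * a (j - i) * (x j)%:R =
  - (a (j - i) * (x j)%:R / (x i)%:R * ln (u i)) by rewrite ltrN2.
by field; rewrite gt_eqF.
Qed.

Lemma sum_race_exponent x i : (0 < x i)%N ->
  (1 + \sum_(h <- neighbours ha | h != 0) race_exponent x i h)^-1 = psi a x i.
Proof.
move=> xi0; have xi0' : 0 < (x i)%:R :> R by rewrite ltr0n.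
rewrite psiE (bigD1_seq 0 (mem0_neighbours ha) (neighbours_uniq ha))/=.
rewrite rate0// addr0 mul1r /race_exponent -mulr_suml.
set S := \sum_(h <- _ | _) _.
have S0 : 0 <= S by apply: sumr_ge0 => h _; rewrite mulr_ge0// rate_ge0.
have X0 : (x i)%:R != 0 :> R by rewrite gt_eqF.
have XS : (x i)%:R + S != 0 by rewrite gt_eqF// ltr_pwDl.
by field; rewrite X0 XS.
Qed.

Lemma powR_sum (r : seq (site d)) (p : pred (site d)) (f : site d -> R) (v : R) :
  0 < v -> \prod_(h <- r | p h) v `^ f h = v `^ (\sum_(h <- r | p h) f h).
Proof.
move=> v0; elim: r => [|h r IH]; first by rewrite !big_nil powRr0.
rewrite !big_cons; case: (p h) => //.
by rewrite IH powRD// (gt_eqF v0) implybT.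
Qed.

Lemma psi_le_transmits dT (T : measurableType dT) (P : probability T R) (V : T -> driver R d)
    (x : state d) i : driven qN unif P V ->
  ((psi a x i)%:E <= P [set t | transmits alg a x (service (V t) 0) i])%E.
Proof.
move=> VP; have [mV _] := VP.
have [xi0|xi0] := posnP (x i); first by rewrite (psiE ha) xi0 mul0r measure_ge0.
have mtr dS (S : measurableType dS) (W : S -> driver R d) (alg' : service_algorithm) :
    measurable_fun setT W ->
    measurable [set t | transmits alg' a x (service (W t) 0) i].
  move=> mW; apply: (measurable_transmits ha (x := fun=> x)) => // j.
  exact: measurable_service.
case: alg; last first.
  rewrite -(uniform_itvoo (c := psi a x i)); last by rewrite psi_ge0// psi_le1.
  rewrite -(driven_service1 (0%N, i) VP); last exact: measurable_itv.
  apply: le_measure; [| |].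
  - apply: mem_set; rewrite -[X in measurable X]setTI.
    by apply: (measurable_driver_snd (0%N, i) mV) => //; exact: measurable_itv.
  - exact/mem_set/mtr.
  - move=> t /=; rewrite in_itv/= => /andP[_ h]; rewrite xi0/=.
    by rewrite /service gt_min h.
(* Under (D1), the variables of site [i] and those of all other sites are taken from two independent
   copies, so the product measure can be computed by sections at a fixed own variable. *)
pose b (e : nat * site d) := e.2 == i.
pose W (z : T * T) : driver R d := fun e => if b e then V z.1 e else V z.2 e.
have WP : driven qN unif (P \x P)%E W by apply: driven_splice => // ? ?.
have -> : P [set t | transmits D1 a x (service (V t) 0) i] =
    (P \x P)%E [set z | transmits D1 a x (service (W z) 0) i].
  pose A := [set w : driver R d | transmits D1 a x (service w 0) i].
  have mA : measurable A by exact: (mtr _ _ id).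
  exact: (driven_law VP WP mA).
set ex := race_exponent x i.
pose s := [seq (0%N, i + h) | h <- neighbours ha & h != 0].
have us : uniq s.
  rewrite map_inj_in_uniq ?filter_uniq ?neighbours_uniq//.
  by move=> h h' _ _ [] /addrI.
(* Boundary values are discarded: an event included in the transmission event suffices for a lower
   bound. *)
pose S := [set z : T * T | [/\ 0 < (V z.1 (0%N, i)).2 < 1 &
  forall h, h \in neighbours ha -> h != 0 ->
    0 < (V z.2 (0%N, i + h)).2 < (V z.1 (0%N, i)).2 `^ ex h]].
have mV1 e : measurable_fun setT (fun z : T * T => (V z.1 e).2).
  exact: (measurable_driver_snd (w := V \o fst) _ (measurableT_comp mV measurable_fst)).
have mV2 e : measurable_fun setT (fun z : T * T => (V z.2 e).2).
  exact: (measurable_driver_snd (w := V \o snd) _ (measurableT_comp mV measurable_snd)).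
have mS : measurable S.
  rewrite (_ : S = ([set z | 0 < (V z.1 (0%N, i)).2] `&` [set z | (V z.1 (0%N, i)).2 < 1])
    `&` \bigcap_(h in [set` [seq h <- neighbours ha | h != 0]])
     ([set z | 0 < (V z.2 (0%N, i + h)).2] `&`
      [set z | (V z.2 (0%N, i + h)).2 < (V z.1 (0%N, i)).2 `^ ex h])).
    apply: measurableI; first by apply: measurableI; exact: measurable_ltr_set.
    apply: fin_bigcap_measurable => // h _; apply: measurableI; apply: measurable_ltr_set => //.
    exact: (measurableT_comp (measurable_powR _) (mV1 _)).
  apply/seteqP; split => z /=.
    move=> [/andP[h1 h2] H]; split => // h; rewrite /= mem_filter => /andP[h0 hN].
    by have /andP[] := H h hN h0.
  move=> [[h1 h2] H]; split; first by rewrite h1 h2.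
  by move=> h hN h0; have [|/= -> ->] := H h; rewrite /= ?mem_filter ?h0.
apply: (@le_trans _ _ ((P \x P)%E S)); last first.
  apply: le_measure; [exact: mem_set| |].
    by apply/mem_set/mtr; have [] := WP.
  move=> z [u01 H]; apply: race_transmits => //.
    by rewrite /W /b/= eqxx.
  move=> h hN h0; rewrite /W /b/= eqxx.
  have -> : (i + h == i) = false.
    by rewrite -subr_eq0 addrAC subrr add0r (negbTE h0).
  exact: H.
rewrite -(sum_race_exponent xi0) -/ex.
rewrite -uniform_powR; last by apply: sumr_ge0 => h _; exact: race_exponent_ge0.
set r := \sum_(h <- _ | _) _.
rewrite -(driven_service_integral (0%N, i) (f := fun v => (if 0 < v < 1 then v `^ r else 0)%:E) VP); last 2 first.
- apply/measurable_EFinP; apply: measurable_fun_ifT => //.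
  apply: measurable_and.
    exact: (measurable_fun_ltr (measurable_cst (0 : R)) (@measurable_id _ _ setT)).
  exact: (measurable_fun_ltr (@measurable_id _ _ setT) (measurable_cst (1 : R))).
- by move=> v; case: ifP => _; rewrite lee_fin ?powR_ge0.
rewrite /= /product_measure1; apply: ge0_le_integral => //.
- by move=> t _; case: ifP => _; rewrite lee_fin ?powR_ge0.
- apply/measurable_EFinP; apply: measurable_fun_ifT => //.
    apply: measurable_and.
      by apply: measurable_fun_ltr => //; exact: measurable_driver_snd.
    by apply: measurable_fun_ltr => //; exact: measurable_driver_snd.
  exact: (measurableT_comp (measurable_powR _) (measurable_driver_snd _ mV)).
- exact: measurable_fun_xsection.
move=> t _ /=; case: ifPn => [v01|_]; last exact: measure_ge0.
set v := (V t (0%N, i)).2 in v01 *; have /andP[v0 v1] := v01.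
(* At fixed [v] the rivals are independent, so the section is a cylinder over [s], and its intervals
   have lengths [v] to the race exponents, whose product adds the exponents. *)
pose B (e : nat * site d) : set R := `]0, v `^ ex (e.2 - i)[%classic.
have -> : xsection S t = [set t' | forall e, e \in s -> B e (V t' e).2].
  apply/seteqP; split => t'; rewrite /xsection/= inE/=.
    move=> [_ H] e /mapP[h]; rewrite mem_filter => /andP[h0 hN] ->.
    by rewrite /B/= in_itv/= [i + h]addrC addrK [h + i]addrC; exact: H.
  move=> H; split => // h hN h0.
  have := H (0%N, i + h); rewrite /B/= in_itv/= [X in ex (X - _)]addrC addrK; apply.
  by apply/mapP; exists h => //; rewrite mem_filter h0.
rewrite (driven_service VP)//; last by move=> e; exact: measurable_itv.
rewrite /s big_map big_filter -powR_sum// -prodEFin.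
rewrite le_eqVlt; apply/orP; left; apply/eqP; apply: eq_bigr => h h0.
rewrite /B/= [X in ex (X - _)]addrC addrK uniform_itvoo// powR_ge0/=.
by rewrite powR_le1 ?race_exponent_ge0// v0 ltW.
Qed.

End transmission_probability.

(** * Second moments *)

Section real_expectation.
Context (R : realType) dT (T : measurableType dT) (P : probability T R).

Implicit Types f g : T -> R.

Definition mean (f : T -> R) : \bar R := (\int[P]_t (f t)%:E)%E.

Lemma mean_ge0 f : (forall t, 0 <= f t) -> (0 <= mean f)%E.
Proof. by move=> f0; apply: integral_ge0 => t _; rewrite lee_fin. Qed.

Lemma mean_cst r : mean (fun=> r) = r%:E.
Proof.
rewrite /mean -[RHS]mule1 -(probability_setT P).
by rewrite -(integral_cst P measurableT).
Qed.

Lemma le_mean f g : measurable_fun setT f -> measurable_fun setT g ->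
  (forall t, 0 <= f t) -> (forall t, f t <= g t) -> (mean f <= mean g)%E.
Proof.
move=> mf mg f0 fg; apply: ge0_le_integral => //; try exact/measurable_EFinP.
  by move=> t _; rewrite lee_fin.
by move=> t _; rewrite lee_fin.
Qed.

Lemma meanD f g : measurable_fun setT f -> measurable_fun setT g ->
  (forall t, 0 <= f t) -> (forall t, 0 <= g t) ->
  mean (fun t => f t + g t) = (mean f + mean g)%E.
Proof.
move=> mf mg f0 g0; rewrite /mean; under eq_integral do rewrite EFinD.
by rewrite ge0_integralD//; first [exact/measurable_EFinP|move=> t _; rewrite lee_fin].
Qed.

Lemma meanZ (k : R) f : measurable_fun setT f -> (forall t, 0 <= f t) -> 0 <= k ->
  mean (fun t => k * f t) = (k%:E * mean f)%E.
Proof.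
move=> mf f0 k0; rewrite /mean; under eq_integral do rewrite EFinM.
by rewrite ge0_integralZl//; first [exact/measurable_EFinP|move=> t _; rewrite lee_fin].
Qed.

Lemma mean_sum (I : Type) (r : seq I) (f : I -> T -> R) :
  (forall i, measurable_fun setT (f i)) -> (forall i t, 0 <= f i t) ->
  mean (fun t => \sum_(i <- r) f i t) = (\sum_(i <- r) mean (f i))%E.
Proof.
move=> mf f0; elim: r => [|i r IH].
  by under [X in mean X]eq_fun do rewrite big_nil; rewrite big_nil mean_cst.
under [X in mean X]eq_fun do rewrite big_cons.
rewrite big_cons meanD ?IH//; first exact: measurable_sum.
by move=> t; apply: sumr_ge0 => j _.
Qed.

End real_expectation.

(** * One-slot drift of the cube of a queue, from a fixed state *)

Section drift.
Context (R : realType) (d : nat) (a : site d -> R) (ha : interference_rates a)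
  (alg : service_algorithm) (qN : set nat -> \bar R).
Hypothesis qN1 : qN setT = 1%E.
Local Notation unif := (uniform_prob (@ltr01 R)).
Context dT (T : measurableType dT) (P : probability T R) (V : T -> driver R d).
Hypothesis VP : driven qN unif P V.
Variables (lam e2 e3 : R).
Let xi t : R := (arrival (V t) 0 0)%:R.
Hypothesis lamE : mean P xi = lam%:E.
Hypothesis e2E : mean P (fun t => xi t ^+ 2) = e2%:E.
Hypothesis e3E : mean P (fun t => xi t ^+ 3) = e3%:E.
Local Notation A := (total_rate ha).

Let mV : measurable_fun setT V := VP.1.

Let mxi n : measurable_fun setT (fun t => xi t ^+ n).
Proof. by apply: measurable_funX; apply: measurable_fun_natr; exact: measurable_arrival. Qed.

Let mxi1 : measurable_fun setT xi.
Proof. by apply: measurable_fun_natr; exact: measurable_arrival. Qed.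

Let xi0 t : 0 <= xi t. Proof. exact: ler0n. Qed.

Lemma e3_ge0 : 0 <= e3.
Proof. by rewrite -lee_fin -e3E; apply: mean_ge0 => t; rewrite exprn_ge0. Qed.

Lemma lam_ge0 : 0 <= lam.
Proof. by rewrite -lee_fin -lamE; exact: mean_ge0. Qed.

(** Expand [(X + (Y - b)) ^+ 3], keep the departure term of order [X ^+ 2] on the left, and bound
    the rest by [(Y - b) ^+ 2 <= Y ^+ 2 + 1] and [(Y - b) ^+ 3 <= Y ^+ 3]. *)
Lemma cubic_increment (X Y : R) (b : bool) : 0 <= X -> 0 <= Y -> (b -> 1 <= X) ->
  (X + Y - b%:R) ^+ 3 + 3 * X ^+ 2 * b%:R <=
  X ^+ 3 + 3 * X ^+ 2 * Y + 3 * X * (Y ^+ 2 + 1) + Y ^+ 3.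
Proof.
move=> X0 Y0; case: b => /= X1.
  have XY : 0 <= X * Y by rewrite mulr_ge0.
  rewrite -subr_ge0 [X in 0 <= X](_ : _ = 6 * (X * Y) + 3 * Y * (Y - 1) + 1)//; last by ring.
  nra.
rewrite -subr_ge0 [X in 0 <= X](_ : _ = 3 * X); last by ring.
by rewrite mulr_ge0.
Qed.

(** The tangent bound, multiplied out, is [X * (A * X - S) ^+ 2 / S >= 0]. Each product of two
    queues in [S * X] is at most half the sum of their squares, so only single-site second moments
    will have to be averaged. *)
Lemma interference_tradeoff (x : state d) :
  2 * A * (x 0)%:R ^+ 2 <= A ^+ 2 * ((x 0)%:R ^+ 2 * psi a x 0) +
    \sum_(h <- neighbours ha) a h * (((x h)%:R ^+ 2 + (x 0)%:R ^+ 2) / 2).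
Proof.
set X : R := (x 0)%:R; have A0 := total_rate_gt0 ha.
have E : \sum_(h <- neighbours ha) a h * (x (0 + h))%:R =
    \sum_(h <- neighbours ha) a h * (x h)%:R :> R.
  by apply: eq_bigr => h _; rewrite add0r.
rewrite (psiE ha); have := interference_ge ha x 0; rewrite E -/X.
set S := \sum_(h <- _) a h * (x h)%:R => XS.
have SX : S * X <= \sum_(h <- neighbours ha) a h * (((x h)%:R ^+ 2 + X ^+ 2) / 2).
  rewrite mulr_suml; apply: ler_sum => h _; rewrite -mulrA.
  apply: ler_wpM2l; first exact: rate_ge0.
  have := sqr_ge0 ((x h)%:R - X); nra.
apply: (le_trans _ (lerD (lexx _) SX)).
have X0 : 0 <= X by [].
move: X0; rewrite le_eqVlt => /predU1P[<-|X0].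
  by rewrite expr0n/= !(mulr0, mul0r) addr0.
have S0 : 0 < S by exact: lt_le_trans XS.
rewrite -subr_ge0 [X in 0 <= X](_ : _ = X * (A * X - S) ^+ 2 / S).
  by rewrite divr_ge0 ?(ltW S0)// mulr_ge0 ?(ltW X0)// sqr_ge0.
by field; rewrite gt_eqF.
Qed.

Definition next_queue (x : state d) (t : T) : R :=
  (step alg a (arrival (V t) 0) (service (V t) 0) x 0)%:R.

Lemma measurable_next_queue x n : measurable_fun setT (fun t => next_queue x t ^+ n).
Proof.
apply: measurable_funX; apply: measurable_fun_natr.
apply: (measurable_step ha (x := fun=> x)) => // i.
  exact: measurable_service.
exact: measurable_arrival.
Qed.

Lemma next_queue_cube (x : state d) :
  (mean P (fun t => (next_queue x t ^+ 3)%R) + (3 * (x 0)%:R ^+ 2 * psi a x 0)%:E <=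
   ((x 0)%:R ^+ 3 + 3 * lam * (x 0)%:R ^+ 2 + 3 * (e2 + 1) * (x 0)%:R + e3)%:E)%E.
Proof.
set X : R := (x 0)%:R; have X0 : 0 <= X by [].
pose D := [set t | transmits alg a x (service (V t) 0) 0].
have mD : measurable D.
  apply: (measurable_transmits ha (x := fun=> x)) => // i.
  exact: measurable_service.
have X20 : 0 <= 3 * X ^+ 2 by rewrite mulr_ge0 ?sqr_ge0.
apply: (@le_trans _ _ (mean P (fun t => (next_queue x t ^+ 3)%R)
    + mean P (fun t => (3 * X ^+ 2 * \1_D t)%R))%E).
  apply: leeD => //.
  rewrite meanZ//.
  rewrite EFinM; apply: lee_wpmul2l; first by rewrite lee_fin.
  by rewrite /mean integral_indic// setIT; exact: (psi_le_transmits ha alg qN1 x 0 VP).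
rewrite -meanD//; last 4 first.
- exact: measurable_next_queue.
- by apply: measurable_funM => //; exact: measurable_indic.
- by move=> t; rewrite exprn_ge0.
- by move=> t; rewrite mulr_ge0.
apply: (@le_trans _ _ (mean P (fun t =>
   (X ^+ 3 + 3 * X) + (3 * X ^+ 2 * xi t + (3 * X * xi t ^+ 2 + xi t ^+ 3))))).
  apply: le_mean.
  - apply: measurable_funD; first exact: measurable_next_queue.
    by apply: measurable_funM => //; exact: measurable_indic.
  - apply: measurable_funD => //; apply: measurable_funD; first exact: measurable_funM.
    by apply: measurable_funD => //; exact: measurable_funM.
  - by move=> t; rewrite addr_ge0 ?exprn_ge0// mulr_ge0.
  - move=> t; have -> : \1_D t = (transmits alg a x (service (V t) 0) 0)%:R :> R.
      rewrite indicE; congr (_%:R); congr (nat_of_bool _).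
      by apply/idP/idP => [/set_mem|h]; last exact/mem_set.
    have tX : transmits alg a x (service (V t) 0) 0 -> 1 <= X.
      by rewrite ler1n; case: alg => /= /andP[].
    (* The truncated subtraction is a true one: a transmitting queue is nonempty. *)
    rewrite /next_queue /step natrB; last first.
      by move: tX; rewrite ler1n; case: (transmits _ _ _) => // /(_ isT) h;
        rewrite (leq_trans h)// leq_addr.
    rewrite natrD; apply: (le_trans (cubic_increment X0 (xi0 t) tX)).
    rewrite -/X -/(xi t); lra.
rewrite meanD//; last 3 first.
- apply: measurable_funD; first exact: measurable_funM.
  by apply: measurable_funD => //; exact: measurable_funM.
- by move=> t; rewrite addr_ge0 ?exprn_ge0// mulr_ge0.
- by move=> t; rewrite addr_ge0 ?mulr_ge0 ?exprn_ge0// addr_ge0 ?mulr_ge0 ?exprn_ge0.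
rewrite mean_cst meanD//; last 4 first.
- exact: measurable_funM.
- by apply: measurable_funD => //; exact: measurable_funM.
- by move=> t; rewrite mulr_ge0.
- by move=> t; rewrite addr_ge0 ?mulr_ge0 ?exprn_ge0.
rewrite meanD//; last 3 first.
- exact: measurable_funM.
- by move=> t; rewrite mulr_ge0 ?exprn_ge0 ?mulr_ge0.
- by move=> t; rewrite exprn_ge0.
rewrite !meanZ//; [|by move=> t; rewrite exprn_ge0|by rewrite mulr_ge0].
rewrite lamE e2E e3E -!EFinM -!EFinD lee_fin; lra.
Qed.

End drift.

(** * Uniform second-moment bound for the backward queues *)

Section second_moment.
Context (R : realType) (d : nat) (a : site d -> R) (ha : interference_rates a)
  (alg : service_algorithm) (qN : set nat -> \bar R).
Hypothesis qN1 : qN setT = 1%E.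
Local Notation unif := (uniform_prob (@ltr01 R)).
Context dT (T : measurableType dT) (P : probability T R) (V : T -> driver R d).
Hypothesis VP : driven qN unif P V.
Variables (lam e2 e3 : R).
Hypothesis lamE : mean P (fun t => (arrival (V t) 0 0)%:R) = lam%:E.
Hypothesis e2E : mean P (fun t => (arrival (V t) 0 0)%:R ^+ 2) = e2%:E.
Hypothesis e3E : mean P (fun t => (arrival (V t) 0 0)%:R ^+ 3) = e3%:E.
Local Notation A := (total_rate ha).
Hypothesis subcritical : lam < A^-1.
Local Notation delta := (A^-1 - lam).

Definition drift_constant : R := e3 + 3 * (e2 + 1) ^+ 2 / (2 * delta).
Local Notation K := drift_constant.

Let delta0 : 0 < delta. Proof. by rewrite subr_gt0. Qed.
Let A0 : 0 < A. Proof. exact: total_rate_gt0. Qed.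

Lemma drift_constant_ge0 : 0 <= K.
Proof.
apply: addr_ge0; first exact: (e3_ge0 e3E).
by apply: divr_ge0; apply: mulr_ge0; rewrite ?sqr_ge0// ltW.
Qed.

(** All terms are nonnegative, so their possibly infinite means can be added term by term; the gain
    [6 / A * X ^+ 2] stays on the other side of [drift_bound]. Both it and the weight
    [3 / (2 * A ^+ 2)] come from multiplying the trade-off by [3 / A ^+ 2]. *)
Definition drift_majorant (x : state d) : R :=
  ((x 0)%:R ^+ 3 + (3 * lam + 3 / 2 * delta) * (x 0)%:R ^+ 2) +
  (K + 3 / (2 * A ^+ 2) *
    \sum_(h <- neighbours ha) a h * ((x h)%:R ^+ 2 + (x 0)%:R ^+ 2)).

Lemma drift_bound (x : state d) :
  (mean P (fun t => (next_queue a alg V x t ^+ 3)%R) + (6 / A * (x 0)%:R ^+ 2)%:E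
    <= (drift_majorant x)%:E)%E.
Proof.
have := next_queue_cube ha alg qN1 VP lamE e2E e3E x.
have := interference_tradeoff ha x.
rewrite /drift_majorant; set X : R := (x 0)%:R; set ps := psi a x 0.
set m := mean _ _ => H1; rewrite -leeBrDr// -EFinB => H2.
rewrite -leeBrDr// -EFinB; apply: (le_trans H2); rewrite lee_fin.
set S := \sum_(h <- _) _ in H1; set S' := \sum_(h <- _) _.
have SS' : S = S' / 2.
  by rewrite mulr_suml; apply: eq_bigr => h _; rewrite mulrA.
rewrite SS' in H1.
have Ai : A != 0 by rewrite gt_eqF.
have {}H1 : 6 / A * X ^+ 2 <= 3 * X ^+ 2 * ps + 3 / (2 * A ^+ 2) * S'.
  have c0 : 0 <= 3 / A ^+ 2 by rewrite divr_ge0// sqr_ge0.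
  have := ler_wpM2l c0 H1.
  rewrite (_ : 3 / A ^+ 2 * (2 * A * X ^+ 2) = 6 / A * X ^+ 2); last by field.
  rewrite (_ : 3 / A ^+ 2 * _ = 3 * X ^+ 2 * ps + 3 / (2 * A ^+ 2) * S')//.
  by field.
have H3 : 3 * (e2 + 1) * X <= 3 / 2 * delta * X ^+ 2 + 3 * (e2 + 1) ^+ 2 / (2 * delta).
  move: delta0; move: delta => D D0.
  rewrite -subr_ge0 [X in 0 <= X](_ : _ = 3 / (2 * D) * (D * X - (e2 + 1)) ^+ 2).
    by rewrite mulr_ge0 ?sqr_ge0// divr_ge0// mulr_ge0// ltW.
  by field; rewrite gt_eqF.
rewrite /drift_constant; set Z := 3 / (2 * A ^+ 2) * S' in H1 *.
set Y := 3 * (e2 + 1) ^+ 2 / (2 * delta) in H3 *.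
set W := 6 / A * X ^+ 2 in H1 *.
move: H1 H3; lra.
Qed.

Definition moment (p n : nat) : \bar R :=
  mean P (fun t => ((backward a alg n (V t) 0)%:R ^+ p)%R).

Let mV : measurable_fun setT V := VP.1.

Let mback n i : measurable_fun setT (fun t => backward a alg n (V t) i).
Proof. exact: (measurableT_comp (measurable_backward_coord ha alg n i) mV). Qed.

Let mbackX n i p :
  measurable_fun setT (fun t => (backward a alg n (V t) i)%:R ^+ p : R).
Proof. by apply: measurable_funX; exact: measurable_fun_natr. Qed.

Lemma measurable_backward_moment n p :
  measurable_fun setT (fun w : driver R d => ((backward a alg n w 0)%:R ^+ p)%:E : \bar R).
Proof.
apply/measurable_EFinP; apply: measurable_funX; apply: measurable_fun_natr.
exact: measurable_backward_coord.
Qed.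

Lemma moment_law dS (S : measurableType dS) (Q : probability S R)
    (W : S -> driver R d) p n : driven qN unif Q W ->
  (\int[Q]_s ((backward a alg n (W s) 0)%:R ^+ p)%:E = moment p n)%E.
Proof.
move=> WQ; apply: (driven_integral
  (f := fun w => ((backward a alg n w 0)%:R ^+ p)%:E : \bar R) WQ VP).
  exact: measurable_backward_moment.
by move=> w; rewrite lee_fin exprn_ge0.
Qed.

(** Translating the driver reindexes it injectively, hence preserves its law, and it translates the
    queues. *)
Lemma moment_site p n i :
  mean P (fun t => ((backward a alg n (V t) i)%:R ^+ p)%R) = moment p n.
Proof.
rewrite -(@moment_law _ _ P (fun t => space_shift i (V t))).
  by apply: eq_integral => t _; rewrite backward_space_shift// add0r.
apply: (driven_reindex (sigma := fun e => (e.1, e.2 + i))) => //.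
by move=> [k j] [k' j'] [-> /addIr ->].
Qed.

(** The state built from slots 1, 2, ... is independent of slot 0. Drawing the two from separate
    copies turns the next moment into an iterated integral, with the state frozen in the inner
    one. *)
Lemma moment_step n :
  (\int[P]_t mean P (fun s => (next_queue a alg V (backward a alg n (V t)) s ^+ 3)%R)
    = moment 3 n.+1)%E.
Proof.
pose b (e : nat * site d) := (0 < e.1)%N.
pose W (z : T * T) : driver R d :=
  fun e => if b e then V z.1 (e.1.-1, e.2) else V z.2 e.
have WP : driven qN unif (P \x P)%E W.
  apply: (driven_splice (sigma1 := fun e => (e.1.-1, e.2)) (sigma2 := id)) => //.
  by move=> [[|k] j] [[|k'] j'] //= _ _ [-> ->].
rewrite -(moment_law 3 n.+1 WP).
rewrite fubini_tonelli1/=.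
- apply: eq_integral => t _; apply: eq_integral => s _.
  congr ((_ %:R ^+ 3)%:E); congr (step _ _ _ _ _ _).
  by congr backward; apply/funext => -[k j].
- have [mW _] := WP; exact: (measurableT_comp (measurable_backward_moment n.+1 3) mW).
- by move=> z; rewrite lee_fin exprn_ge0.
Qed.

(** Departures are ignored and [(x + y) ^+ 3 <= 4 * x ^+ 3 + 4 * y ^+ 3]. The bound degrades with
    [n], but finiteness is all that the cancellation in [moment2_bound] requires. *)
Lemma moment3_fin n : (moment 3 n < +oo)%E.
Proof.
elim: n => [|n IH].
  rewrite /moment/=; under [X in mean _ X]eq_fun do rewrite expr0n/=.
  by rewrite mean_cst ltry.
have shiftP : driven qN unif P (fun t => time_shift 1 (V t)).
  apply: (driven_reindex (sigma := fun e => ((1 + e.1)%N, e.2))) => //.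
  by move=> [k j] [k' j'] /eqP; rewrite xpair_eqE eqn_add2l => /andP[/eqP /= -> /eqP ->].
apply: (@le_lt_trans _ _ (mean P (fun t =>
    (4 * (backward a alg n (time_shift 1 (V t)) 0)%:R ^+ 3 +
     4 * (arrival (V t) 0 0)%:R ^+ 3)%R))).
  have mb : measurable_fun setT (fun t => backward a alg n (time_shift 1 (V t)) 0).
    exact: (measurableT_comp (measurable_backward_coord ha alg n 0) shiftP.1).
  have ma : measurable_fun setT (fun t => arrival (V t) 0 0) by exact: measurable_arrival.
  apply: le_mean => //.
  - apply: measurable_funD; apply: measurable_funM => //; apply: measurable_funX;
    exact: measurable_fun_natr.
  move=> t /=; set B := backward a alg n _; set x : R := (B 0)%:R; set y : R := (arrival _ _ _)%:R.
  apply: (@le_trans _ _ ((x + y) ^+ 3)).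
    apply: lerXn2r; rewrite ?nnegrE ?addr_ge0//.
    by rewrite /x /y -natrD ler_nat; exact: leq_subr.
  have x0 : 0 <= x by []. have y0 : 0 <= y by [].
  rewrite -subr_ge0 [X in 0 <= X](_ : _ = 3 * (x + y) * (x - y) ^+ 2); last by ring.
  by rewrite mulr_ge0 ?sqr_ge0// mulr_ge0// addr_ge0.
rewrite meanD; last 4 first.
- by apply: measurable_funM => //; apply: measurable_funX; apply: measurable_fun_natr;
    exact: (measurableT_comp (measurable_backward_coord ha alg n 0) shiftP.1).
- by apply: measurable_funM => //; apply: measurable_funX; apply: measurable_fun_natr;
    exact: measurable_arrival.
- by move=> t; rewrite mulr_ge0// exprn_ge0.
- by move=> t; rewrite mulr_ge0// exprn_ge0.
rewrite !meanZ//; last 2 first.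
- by apply: measurable_funX; apply: measurable_fun_natr; exact: measurable_arrival.
- by apply: measurable_funX; apply: measurable_fun_natr;
    exact: (measurableT_comp (measurable_backward_coord ha alg n 0) shiftP.1).
rewrite e3E {1}/mean (moment_law 3 n shiftP) lte_add_pinfty ?ltry//.
by rewrite lte_mul_pinfty.
Qed.

Lemma moment_ge0 p n : (0 <= moment p n)%E.
Proof. by apply: mean_ge0 => t; rewrite exprn_ge0. Qed.

Lemma moment2_le3 n : (moment 2 n <= moment 3 n)%E.
Proof.
apply: le_mean => // t.
rewrite -!natrX ler_nat; case: (backward _ _ _ _ _) => // k.
by rewrite leq_pexp2l.
Qed.

Lemma moment3_leS n : (moment 3 n <= moment 3 n.+1)%E.
Proof.
apply: le_mean => // t.
by rewrite lerXn2r ?nnegrE// ler_nat backward_leS.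
Qed.

Lemma mean_drift_majorant n :
  mean P (fun t => drift_majorant (backward a alg n (V t))) =
  (moment 3 n + (3 * lam + 3 / 2 * delta)%:E * moment 2 n +
    (K%:E + (3 / A)%:E * moment 2 n))%E.
Proof.
have l0 := lam_ge0 lamE; have K0 := drift_constant_ge0.
have k0 : 0 <= 3 * lam + 3 / 2 * delta.
  by rewrite addr_ge0// mulr_ge0// ltW.
have k1 : 0 <= 3 / (2 * A ^+ 2) by rewrite divr_ge0// mulr_ge0// sqr_ge0.
have a0 h : 0 <= a h by exact: rate_ge0.
have mS : measurable_fun setT (fun t => \sum_(h <- neighbours ha) a h *
   ((backward a alg n (V t) h)%:R ^+ 2 + (backward a alg n (V t) 0)%:R ^+ 2) : R).
  by apply: measurable_sum => h; apply: measurable_funM => //; exact: measurable_funD.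
have S0 t : 0 <= \sum_(h <- neighbours ha) a h *
   ((backward a alg n (V t) h)%:R ^+ 2 + (backward a alg n (V t) 0)%:R ^+ 2) :> R.
  by apply: sumr_ge0 => h _; rewrite mulr_ge0// addr_ge0// exprn_ge0.
rewrite /drift_majorant meanD; last 4 first.
- by apply: measurable_funD => //; exact: measurable_funM.
- by apply: measurable_funD => //; exact: measurable_funM.
- by move=> t; rewrite addr_ge0 ?exprn_ge0// mulr_ge0 ?exprn_ge0.
- by move=> t; rewrite addr_ge0// mulr_ge0.
rewrite meanD//; last 2 first.
- exact: measurable_funM.
- by move=> t; rewrite mulr_ge0 ?exprn_ge0.
rewrite meanD//; last 2 first.
- exact: measurable_funM.
- by move=> t; rewrite mulr_ge0.
rewrite mean_cst !meanZ//.
congr (_ + (_ + _))%E.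
rewrite mean_sum; last 2 first.
- by move=> h; apply: measurable_funM => //; exact: measurable_funD.
- by move=> h t; rewrite mulr_ge0// addr_ge0// exprn_ge0.
have m2 : moment 2 n \is a fin_num.
  rewrite ge0_fin_numE ?moment_ge0//.
  exact: (le_lt_trans (moment2_le3 n) (moment3_fin n)).
have siteE h : mean P (fun t => (a h * ((backward a alg n (V t) h)%:R ^+ 2 +
    (backward a alg n (V t) 0)%:R ^+ 2))%R) =
    (a h * (fine (moment 2 n) + fine (moment 2 n)))%:E.
  rewrite EFinM EFinD !fineK// -{1}(moment_site 2 n h) meanZ//.
  - by rewrite meanD.
  - exact: measurable_funD.
under eq_bigr do rewrite siteE.
rewrite sumEFin -mulr_suml -/(total_rate ha) -EFinM -(fineK m2) -EFinM /=.
congr (_%:E); field.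
by rewrite gt_eqF.
Qed.

(** A single step suffices, without summing over [n]: third moments increase with [n], so they
    cancel. The coefficient left on the second moment is [6 / A - 3 / A - 3 * lam - 3 / 2 * delta],
    that is [3 / 2 * delta]. *)
Lemma moment2_bound n : (moment 2 n <= (2 * K / (3 * delta))%:E)%E.
Proof.
have m2 : moment 2 n \is a fin_num.
  rewrite ge0_fin_numE ?moment_ge0//.
  exact: (le_lt_trans (moment2_le3 n) (moment3_fin n)).
have m3 k : moment 3 k \is a fin_num by rewrite ge0_fin_numE ?moment_ge0// moment3_fin.
have mnext : measurable_fun setT (fun t =>
    mean P (fun s => (next_queue a alg V (backward a alg n (V t)) s ^+ 3)%R)).
  pose f (z : T * T) := ((next_queue a alg V (backward a alg n (V z.1)) z.2) ^+ 3)%:E.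
  apply: (measurable_fun_fubini_tonelli_F f).
    apply/measurable_EFinP; apply: measurable_funX; apply: measurable_fun_natr.
    have mV2 : measurable_fun setT (fun z : T * T => V z.2).
      exact: (measurableT_comp mV measurable_snd).
    apply: (measurable_step ha (x := fun z : T * T => backward a alg n (V z.1))) => i.
    - exact: (measurableT_comp (mback n i) measurable_fst).
    - exact: measurable_service.
    - exact: measurable_arrival.
  by move=> z; rewrite /f lee_fin exprn_ge0.
have : (moment 3 n.+1 + (6 / A)%:E * moment 2 n <=
    mean P (fun t => drift_majorant (backward a alg n (V t))))%E.
  rewrite -moment_step -meanZ//; last by rewrite divr_ge0// ltW.
  rewrite /mean -ge0_integralD//; last 3 first.
  - by move=> t _; apply: integral_ge0 => s _; rewrite lee_fin exprn_ge0.
  - by move=> t _; rewrite lee_fin mulr_ge0 ?exprn_ge0// divr_ge0// ltW.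
  - by apply/measurable_EFinP; exact: measurable_funM.
  apply: ge0_le_integral => //.
  - move=> t _; rewrite adde_ge0//.
      by apply: integral_ge0 => s _; rewrite lee_fin exprn_ge0.
    by rewrite lee_fin mulr_ge0 ?exprn_ge0// divr_ge0// ltW.
  - apply: emeasurable_funD => //.
    by apply/measurable_EFinP; exact: measurable_funM.
  - apply/measurable_EFinP; apply: measurable_funD.
      by apply: measurable_funD => //; exact: measurable_funM.
    apply: measurable_funD => //; apply: measurable_funM => //.
    by apply: measurable_sum => h; apply: measurable_funM => //; exact: measurable_funD.
  - by move=> t _; exact: drift_bound.
rewrite mean_drift_majorant => H.
have {H} : (moment 3 n + (6 / A)%:E * moment 2 n <=
  moment 3 n + (3 * lam + 3 / 2 * delta)%:E * moment 2 n +
    (K%:E + (3 / A)%:E * moment 2 n))%E.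
  by apply: le_trans H; rewrite leeD2r// moment3_leS.
rewrite -(fineK m2) -(fineK (m3 n)) -!EFinM -!EFinD !lee_fin.
set m := fine (moment 2 n) => H.
have d0 : 0 < 3 * delta by rewrite mulr_gt0.
rewrite ler_pdivlMr//.
move: H; nra.
Qed.

End second_moment.

(** * The lower invariant measure *)

Section almost_sure.
Context (R : realType) dT (T : measurableType dT) (P : probability T R).

Lemma probability1_setI (G B : set T) : measurable G -> measurable B -> P G = 1%E ->
  P (B `&` G) = P B.
Proof.
move=> mG mB PG.
have mGc : measurable (~` G) by exact: measurableC.
have PGc : P (~` G) = 0%E by rewrite probability_setC// PG subee.
rewrite [in RHS](_ : B = (B `&` G) `|` (B `&` ~` G)); last first.
  by rewrite -setIUr setUv setIT.
rewrite measureU0//; try exact: measurableI.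
by apply: (subset_measure0 (mu := P) _ mGc) => //; exact: measurableI.
Qed.

Lemma eq_probability_on (G B C : set T) : measurable G -> measurable B ->
  measurable C -> P G = 1%E -> (forall t, G t -> B t <-> C t) -> P B = P C.
Proof.
move=> mG mB mC PG BC.
rewrite -(probability1_setI mG mB PG) -(probability1_setI mG mC PG).
by congr (P _); apply/seteqP; split => t [h Gt]; split => //; apply/(BC t Gt).
Qed.

Lemma probability1_bigcap (I : countType) (F : I -> set T) :
  (forall i, measurable (F i)) -> (forall i, P (F i) = 1%E) ->
  P (\bigcap_i F i) = 1%E.
Proof.
move=> mF PF; have mI := countable_bigcapT_measurable mF.
rewrite -[\bigcap_i _]setCK probability_setC ?setC_bigcap; last first.
  by rewrite -setC_bigcap; exact: measurableC.
suff -> : P (\bigcup_i ~` F i) = 0%E by rewrite sube0.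
pose G n := if choice.unpickle n is Some i then ~` F i else set0.
have mG n : measurable (G n).
  by rewrite /G; case: choice.unpickle => // i; exact: measurableC.
apply/eqP; rewrite -measure_le0.
apply: (@le_trans _ _ (\sum_(n <oo) P (G n))%E).
  apply: measure_sigma_subadditive => //.
    by rewrite -setC_bigcap; exact: measurableC.
  by move=> t [i _ Fit]; exists (choice.pickle i) => //; rewrite /G choice.pickleK.
rewrite eseries0// => n _ _; rewrite /G; case: choice.unpickle => [i|].
  by rewrite probability_setC// PF subee.
by rewrite measure0.
Qed.

Section nondecreasing_means.
Variables (g : nat -> T -> R) (B : R).
Hypothesis mg : forall n, measurable_fun setT (g n).
Hypothesis g0 : forall n t, 0 <= g n t.
Hypothesis ndg : forall m n t, (m <= n)%N -> g m t <= g n t.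
Hypothesis gB : forall n, (mean P (g n) <= B%:E)%E.

Definition mean_limit t : \bar R := ereal_sup (range (fun n => (g n t)%:E)).

Let cvg_mean_limit t : (g n t)%:E @[n --> \oo] --> mean_limit t.
Proof. by apply: ereal_nondecreasing_cvgn => m n mn; rewrite lee_fin; exact: ndg. Qed.

Lemma le_mean_limit n t : ((g n t)%:E <= mean_limit t)%E.
Proof. by apply: ereal_sup_ubound; exists n. Qed.

Lemma mean_limitE : mean_limit = fun t => limn (fun n => (g n t)%:E).
Proof. by apply/funext => t; apply/esym/cvg_lim => //; exact: cvg_mean_limit. Qed.

Lemma measurable_mean_limit : measurable_fun setT mean_limit.
Proof.
rewrite mean_limitE.
apply: (emeasurable_fun_cvg (fun n t => (g n t)%:E)) => [n|t _].
  exact/measurable_EFinP.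
by rewrite -[limn _](congr1 (@^~ t) mean_limitE); exact: cvg_mean_limit.
Qed.

Lemma integral_mean_limit : (\int[P]_t mean_limit t <= B%:E)%E.
Proof.
rewrite mean_limitE monotone_convergence//.
- apply: lime_le.
    apply: ereal_nondecreasing_is_cvgn => m n mn; apply: ge0_le_integral => //.
    + by move=> t _; rewrite lee_fin.
    + exact/measurable_EFinP.
    + exact/measurable_EFinP.
    + by move=> t _; rewrite lee_fin; exact: ndg.
  by near=> n; exact: gB.
- by move=> n; exact/measurable_EFinP.
- by move=> n t _; rewrite lee_fin.
- by move=> t _ m n mn; rewrite lee_fin; exact: ndg.
Unshelve. all: by end_near. Qed.

Lemma mean_limit_ge0 t : (0 <= mean_limit t)%E.
Proof. by apply: le_trans (le_mean_limit 0 t); rewrite lee_fin. Qed.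

Lemma mean_limit_fin : P [set t | (mean_limit t < +oo)%E] = 1%E.
Proof.
have mI : measurable [set t | (mean_limit t < +oo)%E].
  rewrite -[X in measurable X]setTI; apply: emeasurable_fun_infty_o => //.
  exact: measurable_mean_limit.
have iL : P.-integrable setT mean_limit.
  apply/integrableP; split; first exact: measurable_mean_limit.
  under eq_integral do rewrite gee0_abs ?mean_limit_ge0//.
  exact: (le_lt_trans integral_mean_limit (ltry _)).
have [N [mN PN HN]] := integrable_ae measurableT iL.
apply/eqP; rewrite eq_le probability_le1//=.
have <- : P (~` N) = 1%E by rewrite probability_setC// PN sube0.
apply: le_measure; [exact/mem_set/measurableC|exact: mem_set|].
move=> t Nt /=; apply: contrapT => h; apply: Nt; apply: HN => /= /(_ I).
by rewrite ge0_fin_numE ?mean_limit_ge0.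
Qed.

End nondecreasing_means.
End almost_sure.

Section lower_measure.
Context (R : realType) (d : nat) (a : site d -> R) (ha : interference_rates a)
  (alg : service_algorithm) (qN : set nat -> \bar R).
Local Notation unif := (uniform_prob (@ltr01 R)).
Context dT (T : measurableType dT) (P : probability T R) (V : T -> driver R d).
Hypothesis VP : driven qN unif P V.
Variable B : R.
Hypothesis secondB : forall n i,
  (mean P (fun t => ((backward a alg n (V t) i)%:R ^+ 2)%R) <= B%:E)%E.

Let mV : measurable_fun setT V := VP.1.

Let g i n t : R := (backward a alg n (V t) i)%:R ^+ 2.

Let mg i n : measurable_fun setT (g i n).
Proof.
apply: measurable_funX; apply: measurable_fun_natr.
exact: (measurableT_comp (measurable_backward_coord ha alg n i) mV).
Qed.

Let g0 i n t : 0 <= g i n t. Proof. exact: exprn_ge0. Qed.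

Let ndg i m n t : (m <= n)%N -> g i m t <= g i n t.
Proof.
by move=> mn; rewrite lerXn2r ?nnegrE// ler_nat; exact: (backward_homo alg ha).
Qed.

Let mcvg : measurable [set t | backward_cvg a alg (V t)].
Proof.
rewrite -[X in measurable X]setTI; apply: mV => //.
exact: measurable_backward_cvg.
Qed.

(** By monotone convergence the supremum of the squared queues has finite mean, hence is almost
    surely finite at each of the countably many sites; a bounded nondecreasing integer sequence is
    eventually constant. *)
Lemma backward_cvg_as : P [set t | backward_cvg a alg (V t)] = 1%E.
Proof.
pose F (i : site d) := [set t | (mean_limit (g i) t < +oo)%E].
have mF i : measurable (F i).
  rewrite -[X in measurable X]setTI; apply: emeasurable_fun_infty_o => //.
  by apply: measurable_mean_limit; [exact: mg|move=> *; exact: ndg].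
have PF : P (\bigcap_i F i) = 1%E.
  apply: probability1_bigcap => // i.
  by apply: (mean_limit_fin (B := B)); [exact: mg|exact: g0|move=> *; exact: ndg|move=> n; exact: secondB].
apply/eqP; rewrite eq_le probability_le1//=; rewrite -PF.
apply: le_measure; [|exact: mem_set|].
  by apply: mem_set; exact: countable_bigcapT_measurable.
move=> t Ft i; have := Ft i I; rewrite /F/= => Fi.
have L0 : (0 <= mean_limit (g i) t)%E by exact: mean_limit_ge0.
have Lfin : mean_limit (g i) t \is a fin_num by rewrite ge0_fin_numE.
(* A natural number is at most its square, so the supremum of the squares also bounds the queues. *)
apply: (backward_bounded_cvg ha (m := Num.trunc (fine (mean_limit (g i) t)))) => n.
rewrite truncn_ge_nat ?fine_ge0//.
have := le_mean_limit (g i) n t; rewrite -(fineK Lfin) lee_fin /=; apply: le_trans.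
by rewrite /g -natrX ler_nat; case: (backward _ _ _ _ _) => // k; rewrite leq_pmull.
Qed.

Let mL : measurable_fun setT (fun t => backward_limit a alg (V t)).
Proof. exact: (measurableT_comp (measurable_backward_limit ha alg) mV). Qed.

Definition limit_state : {mfun T >-> state d} :=
  HB.pack (fun t => backward_limit a alg (V t)) (isMeasurableFun.Build _ _ _ _ _ mL).

Definition lower_measure : probability (state d) R := distribution P limit_state.

Lemma lower_measureE A : lower_measure A = P [set t | A (backward_limit a alg (V t))].
Proof. by []. Qed.

Lemma integral_lower_measure (f : state d -> \bar R) : measurable_fun setT f ->
  (forall x, 0 <= f x)%E ->
  (\int[lower_measure]_x f x = \int[P]_t f (backward_limit a alg (V t)))%E.
Proof. by move=> mf f0; rewrite /lower_measure ge0_integral_distribution. Qed.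

Lemma lower_measure_second_moment i :
  (\int[lower_measure]_x ((x i)%:R ^+ 2)%:E <= B%:E)%E.
Proof.
have mc : measurable_fun setT (fun x : state d => ((x i)%:R ^+ 2)%:E : \bar R).
  apply/measurable_EFinP; apply: measurable_funX; apply: measurable_fun_natr.
  exact: measurable_coordinate.
rewrite integral_lower_measure//.
apply: (le_trans _ (integral_mean_limit (mg i) (g0 i) (fun m n t => @ndg i m n t) (fun n => secondB n i))).
apply: ge0_le_integral => //.
- exact: (measurableT_comp mc mL).
- by apply: measurable_mean_limit; [exact: mg|move=> *; exact: ndg].
move=> t _.
have [[v vP]|nv] := pselect (exists v, \forall n \near \oo, backward a alg n (V t) i = v).
  rewrite (backward_limit_near vP); have [n _ /(_ n (leqnn n)) <-] := vP.
  exact: (le_mean_limit (g i) n t).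
rewrite /backward_limit xgetPN ?expr0n/=; last by move=> v vP; apply: nv; exists v.
exact: mean_limit_ge0.
Qed.

(** [W] takes its slots from [k] on from the first copy and its [k] newest slots, in reverse, from
    the second. The run from the limit is then almost surely the limit driven by [W], which has the
    law of [V]. *)
Lemma limit_run_as k A : measurable A ->
  (P \x P)%E [set z | A (run a alg (V z.2) (backward_limit a alg (V z.1)) k)] =
  lower_measure A.
Proof.
move=> mA.
pose b (e : nat * site d) := (k <= e.1)%N.
pose s1 (e : nat * site d) := ((e.1 - k)%N, e.2).
pose s2 (e : nat * site d) := if (e.1 < k)%N then ((k.-1 - e.1)%N, e.2) else e.
pose W (z : T * T) : driver R d := fun e => if b e then V z.1 (s1 e) else V z.2 (s2 e).
have WP : driven qN unif (P \x P)%E W.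
  apply: (driven_splice (sigma1 := s1) (sigma2 := s2)) => //.
    move=> [l i] [l' i']; rewrite /b /s1 !unfold_in /= => lk l'k [ll ->].
    by congr (_, _); lia.
  move=> [l i] [l' i']; rewrite /b /s2 !unfold_in /= -!ltnNge => lk l'k.
  by rewrite lk l'k => -[ll ->]; congr (_, _); lia.
have [mW _] := WP.
have mV1 : measurable_fun setT (fun z : T * T => V z.1).
  exact: (measurableT_comp mV measurable_fst).
have mV2 : measurable_fun setT (fun z : T * T => V z.2).
  exact: (measurableT_comp mV measurable_snd).
transitivity ((P \x P)%E [set z | A (backward_limit a alg (W z))]); last first.
  rewrite lower_measureE.
  have mA' : measurable [set w : driver R d | A (backward_limit a alg w)].
    by rewrite -[X in measurable X]setTI; apply: (measurable_backward_limit ha alg).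
  exact: (driven_law WP VP mA').
apply: (eq_probability_on (G := [set t | backward_cvg a alg (V t)] `*` setT)).
- exact: measurableX.
- have mr := measurable_run ha alg k (measurableT_comp mL measurable_fst) mV2.
  by rewrite -[X in measurable X]setTI; exact: mr.
- have mr := measurableT_comp (measurable_backward_limit ha alg) mW.
  by rewrite -[X in measurable X]setTI; exact: mr.
- transitivity (P [set t | backward_cvg a alg (V t)] * P setT)%E.
    exact: product_measure1E.
  by rewrite backward_cvg_as probability_setT mule1.
move=> [t s] [/= ct _].
have shiftW : time_shift k (W (t, s)) = V t.
  apply/funext => -[l i]; rewrite /time_shift /W /b /s1 /= leq_addr.
  by rewrite addKn.
have [|_ ->] := backward_limit_run (w := W (t, s)) (k := k) (alg := alg) ha.
  by rewrite shiftW.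
rewrite shiftW (_ : run _ _ (reversal k _) _ _ = run a alg (V s) (backward_limit a alg (V t)) k)//.
apply: run_ext => l i lk; rewrite /reversal lk /W /b /s2 /=.
have lk' : (k.-1 - l < k)%N by lia.
rewrite leqNgt lk'/=; congr (V s (_, _)); lia.
Qed.

Lemma stationary_run (nu : probability (state d) R) k A : measurable A ->
  (nu \x P)%E [set z | A (run a alg (V z.2) z.1 k)] =
  (\int[nu]_x P [set t | A (run a alg (V t) x k)])%E.
Proof.
move=> mA; rewrite /product_measure1; apply: eq_integral => x _ /=.
by rewrite xsectionE.
Qed.

Lemma lower_measure_stationary k A : measurable A ->
  (lower_measure \x P)%E [set z | A (run a alg (V z.2) z.1 k)] = lower_measure A.
Proof.
move=> mA; rewrite stationary_run// -(limit_run_as k mA).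
have mS : measurable [set z : state d * T | A (run a alg (V z.2) z.1 k)].
  have mr := measurable_run ha alg k (@measurable_fst _ _ (state d) T)
    (measurableT_comp mV (@measurable_snd _ _ (state d) T)).
  by rewrite -[X in measurable X]setTI; exact: mr.
have mf : measurable_fun setT (fun x => P [set t | A (run a alg (V t) x k)]).
  have := measurable_fun_xsection P mS.
  by congr (measurable_fun _ _); apply/funext => x /=; rewrite xsectionE.
rewrite integral_lower_measure// /product_measure1/=.
by apply: eq_integral => t _ /=; rewrite xsectionE.
Qed.

(** Reversal preserves the law of the driver, so the backward state has the law of a forward run
    from the empty state; the latter lies below the run from [nu] with the same driver. *)
Lemma backward_le_stationary (nu : probability (state d) R) :
  (forall k (A : set (state d)), measurable A ->
    (nu \x P)%E [set z | A (run a alg (V z.2) z.1 k)] = nu A) ->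
  forall k (A : set (state d)), measurable A ->
    (forall x y, (forall i, (x i <= y i)%N) -> A x -> A y) ->
    (P [set t | A (backward a alg k (V t))] <= nu A)%E.
Proof.
move=> nuS k A mA uA; rewrite -(nuS k A mA) stationary_run//.
have revP : driven qN unif P (fun t => reversal k (V t)).
  pose s (e : nat * site d) := if (e.1 < k)%N then ((k.-1 - e.1)%N, e.2) else e.
  rewrite (_ : (fun t => reversal k (V t)) = fun t e => V t (s e)).
    apply: driven_reindex => //; apply: (can_inj (g := s)) => -[l i].
    have [lk|kl] := ltnP l k; last first.
      by have lk : (l < k)%N = false; rewrite ?ltnNge ?kl// /s/= lk/= ?lk.
    have lk' : (k.-1 - l < k)%N by lia.
    by rewrite /s/= lk/= lk'; congr (_, _); lia.
  apply/funext => t; apply/funext => e; rewrite /reversal /s.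
  by case: ifP.
have mA' : measurable [set w : driver R d | A (backward a alg k w)].
  by rewrite -[X in measurable X]setTI; apply: (measurable_backward ha alg).
have -> : P [set t | A (backward a alg k (V t))] =
    P [set t | A (run a alg (V t) (fun=> 0%N) k)].
  rewrite (driven_law VP revP mA'); congr (P _).
  suff E t : backward a alg k (reversal k (V t)) = run a alg (V t) (fun=> 0%N) k.
    by apply/seteqP; split => t /=; rewrite E.
  rewrite backward_run0; apply: run_ext => l i lk; rewrite /reversal/= lk/=.
  rewrite ifT; last by lia.
  by congr (V t (_, _)); lia.
rewrite -[leLHS]mule1 -(probability_setT nu) -(integral_cst nu measurableT)//.
have mS x : measurable [set t | A (run a alg (V t) x k)].
  have mr := measurable_run ha alg k (measurable_cst x) mV.
  by rewrite -[X in measurable X]setTI; exact: mr.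
apply: ge0_le_integral => //.
- have mS' : measurable [set z : state d * T | A (run a alg (V z.2) z.1 k)].
    have mr := measurable_run ha alg k (@measurable_fst _ _ (state d) T)
      (measurableT_comp mV (@measurable_snd _ _ (state d) T)).
    by rewrite -[X in measurable X]setTI; exact: mr.
  have := measurable_fun_xsection P mS'.
  by congr (measurable_fun _ _); apply/funext => x /=; rewrite xsectionE.
- move=> x _; apply: le_measure; [exact: mem_set|exact: mem_set|].
  by move=> t /=; apply: uA => i; exact: (run_mono alg ha).
Qed.

Lemma lower_measure_dominated (nu : probability (state d) R) :
  (forall k (A : set (state d)), measurable A ->
    (nu \x P)%E [set z | A (run a alg (V z.2) z.1 k)] = nu A) ->
  dominated lower_measure nu.
Proof.
move=> nuS; apply: dominatedP => s A uA.
have mA : measurable A.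
  apply: (measurable_finite_support (s := s)) => x y xy; apply: uA => i si.
  by rewrite xy.
pose F n := [set t | A (backward a alg n (V t))].
have mF n : measurable (F n).
  have mr := measurableT_comp (measurable_backward ha alg n) mV.
  by rewrite -[X in measurable X]setTI; exact: mr.
have cvgF : (P \o F) n @[n --> \oo] --> P (\bigcup_n F n).
  apply: nondecreasing_cvg_mu => //; first exact: bigcupT_measurable.
  move=> m n mn; apply/subsetPset => t; apply: uA => i _.
  exact: (backward_homo alg ha).
apply: (@le_trans _ _ (P (\bigcup_n F n))).
  rewrite lower_measureE.
  have mLA : measurable [set t | A (backward_limit a alg (V t))].
    by rewrite -[X in measurable X]setTI; exact: mL.
  rewrite -(probability1_setI mcvg mLA backward_cvg_as).
  apply: le_measure; [exact/mem_set/measurableI|exact/mem_set/bigcupT_measurable|].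
  move=> t [At ct].
  (* Finitely many sites reach their limits together, so the limit enters [A] only if some finite
     stage does; this is where the finite support of [A] is used. *)
  have : \forall n \near \oo, {in s, forall i, backward a alg n (V t) i =
      backward_limit a alg (V t) i}.
    elim: s {uA} => [|i s IH]; first by near=> n => i.
    near=> n => j; rewrite inE => /orP[/eqP ->|].
      by near: n; exact: backward_cvgP.
    by move: j; near: n.
  move=> [n _ /(_ n (leqnn n)) ns]; exists n => //.
  by apply: uA At => i si; rewrite ns.
rewrite -(cvg_lim (@ereal_hausdorff R) cvgF).
apply: lime_le; first by apply/cvg_ex; eexists; exact: cvgF.
near=> n; apply: backward_le_stationary => // x y xy; apply: uA => i _.
exact: xy.
Unshelve. all: by end_near. Qed.

End lower_measure.

(** Domination tests bounded functions only: the square is truncated at level [n], and monotone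
    convergence removes the truncation. *)
Lemma dominated_second_moment (R : realType) (d : nat)
    (mu nu : probability (state d) R) (B : R) i :
  dominated mu nu -> (\int[nu]_x ((x i)%:R ^+ 2)%:E <= B%:E)%E ->
  (\int[mu]_x ((x i)%:R ^+ 2)%:E <= B%:E)%E.
Proof.
move=> dmn nuB.
pose g n (x : state d) : R := (minn (x i) n)%:R ^+ 2.
have mmin n : measurable_fun setT (fun x : state d => minn (x i) n).
  exact: (measurable_fun_nat_op minn (measurable_coordinate i) (measurable_cst n)).
have mg n : measurable_fun setT (g n).
  by apply: measurable_funX; exact: measurable_fun_natr.
have mc : measurable_fun setT (fun x : state d => (x i)%:R ^+ 2 : R).
  by apply: measurable_funX; apply: measurable_fun_natr; exact: measurable_coordinate.
have g0 n x : 0 <= g n x by rewrite exprn_ge0.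
have ndg m n x : (m <= n)%N -> g m x <= g n x.
  move=> mn; rewrite lerXn2r ?nnegrE// ler_nat leq_min geq_minl/=.
  exact: leq_trans (geq_minr _ _) mn.
have gB n : (mean mu (g n) <= B%:E)%E.
  apply: (@le_trans _ _ (mean nu (g n))).
    apply: dmn => //.
      exists (n%:R ^+ 2) => x; rewrite ger0_norm//.
      by rewrite lerXn2r ?nnegrE// ler_nat geq_minr.
    move=> x y xy; rewrite lerXn2r ?nnegrE// ler_nat.
    by rewrite leq_min geq_minr andbT (leq_trans (geq_minl _ _)).
  apply: le_trans nuB; apply: le_mean => // x.
  by rewrite lerXn2r ?nnegrE// ler_nat geq_minl.
apply: (le_trans _ (integral_mean_limit mg g0 ndg gB)).
apply: ge0_le_integral => //.
- exact/measurable_EFinP.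
- exact: measurable_mean_limit.
move=> x _; apply: le_trans (le_mean_limit g (x i) x).
by rewrite /g minnn.
Qed.

(** * Transfer to the driving variables of the network *)

Section network.
Context (R : realType) (d : nat) (a : site d -> R) (ha : interference_rates a)
  (alg : service_algorithm) (dO : measure_display) (Omega : measurableType dO)
  (P : probability Omega R) (xi : nat -> site d -> {RV P >-> nat})
  (U : nat -> site d -> {RV P >-> R}).
Hypothesis hindep : mutually_independent P (driving_events xi U).
Hypothesis hxi_id : forall k i (A : set nat), measurable A ->
  distribution P (xi k i) A = distribution P (xi 0%N 0) A.
Hypothesis hU : forall k i (A : set R), measurable A ->
  distribution P (U k i) A = uniform_prob (@ltr01 R) A.

Definition network_driver (w : Omega) : driver R d :=
  fun e => (xi e.1 e.2 w, U e.1 e.2 w).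

Lemma driven_network :
  driven (distribution P (xi 0%N 0)) (uniform_prob (@ltr01 R)) P network_driver.
Proof.
split.
  apply: measurable_fun_driver => e.
    exact: (measurable_funPT (xi e.1 e.2)).
  exact: (measurable_funPT (U e.1 e.2)).
move=> s B B' us mB'.
pose I := ((nat * site d) + (nat * site d))%type.
(* Arrivals and services at the sites of [s] are listed together, so joint independence yields both
   factors of the product formula at once. *)
pose r : seq I := map inl s ++ map inr s.
pose F (e : I) := match e with
  | inl f => xi f.1 f.2 @^-1` B f | inr f => U f.1 f.2 @^-1` B' f end.
transitivity (P (\bigcap_(e in [set` r]) F e)).
  congr (P _); apply/seteqP; split => w /= H.
    move=> e /=; rewrite mem_cat => /orP[] /mapP[f fs ->] /=; by have [] := H f fs.
  move=> f fs; split.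
    by apply: (H (inl f)) => /=; rewrite mem_cat map_f.
  by apply: (H (inr f)) => /=; rewrite mem_cat orbC map_f.
rewrite hindep; last 2 first.
- rewrite cat_uniq !map_inj_uniq ?us//=; try by move=> e f [].
  by rewrite andbT -all_predC; apply/allP => _ /mapP[f _ ->] /=; apply/negP => /mapP[].
- move=> [[k i]|[k i]] _ /=.
    by exists (B (k, i)) => //; rewrite setTI.
  by exists (B' (k, i)) => //; rewrite setTI.
rewrite big_cat !big_map/= -big_split/=; apply: eq_bigr => -[k i] _ /=.
by congr (_ * _)%E; [exact: hxi_id|exact: hU].
Qed.

Lemma queues_run_as (nu : probability (state d) R) k (A : set (state d)) :
  measurable A ->
  (nu \x P)%E [set z | A (queues alg a (fun l i => xi l i z.2)
    (fun l i => U l i z.2) z.1 k)] =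
  (nu \x P)%E [set z | A (run a alg (network_driver z.2) z.1 k)].
Proof.
move=> mA; rewrite /product_measure1; apply: eq_integral => x _ /=.
rewrite !xsectionE.
(* On this almost sure event truncating the services at 1 changes nothing, so the actual and the
   truncated dynamics coincide. *)
pose G : set Omega := \bigcap_(e : nat * site d) [set w | U e.1 e.2 w <= 1].
have mle e : measurable [set w | U e.1 e.2 w <= 1].
  rewrite (_ : [set w | _] = U e.1 e.2 @^-1` `]-oo, 1]%classic); last first.
    by apply/seteqP; split => w /=; rewrite in_itv.
  rewrite -[X in measurable X]setTI; apply: measurable_funPT => //.
apply: (eq_probability_on (G := G)).
- exact: countable_bigcapT_measurable.
- rewrite -[X in measurable X]setTI.
  apply: (measurable_queues ha alg (x := fun=> x) (xi := fun w l i => xi l i w)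
    (u := fun w l i => U l i w)) => // l i; exact: measurable_funPT.
- rewrite -[X in measurable X]setTI.
  apply: (measurable_run ha alg k (measurable_cst x)) => //.
  by have [] := driven_network.
- apply: probability1_bigcap => // -[k' i].
  rewrite (_ : [set w | _] = U k' i @^-1` `]-oo, 1]%classic); last first.
    by apply/seteqP; split => w /=; rewrite in_itv.
  transitivity (uniform_prob (@ltr01 R) `]-oo, 1]%classic); first exact: hU.
  apply: integral_uniform_pdf1; first exact: ltr01.
  by move=> t /=; rewrite !in_itv/= => /andP[].
move=> w Gw /=.
rewrite (_ : run _ _ _ _ _ = queues alg a (fun l i => xi l i w) (fun l i => U l i w) x k)//.
rewrite /run; congr queues; apply/funext => l; apply/funext => i.
by rewrite /service /= min_l//; exact: (Gw (l, i)).
Qed.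

Lemma stationaryP (nu : probability (state d) R) :
  stationary alg a xi U nu <-> forall k (A : set (state d)), measurable A ->
    (nu \x P)%E [set z | A (run a alg (network_driver z.2) z.1 k)] = nu A.
Proof. by split => H k A mA; have := H k A mA; rewrite queues_run_as. Qed.

End network.

Theorem corollary7 (R : realType) (d : nat) (hd : (0 < d)%N)
    (a : site d -> R) (ha : interference_rates a)
    (alg : service_algorithm)
    (dO : measure_display) (Omega : measurableType dO)
    (P : probability Omega R)
    (xi : nat -> site d -> {RV P >-> nat})
    (U : nat -> site d -> {RV P >-> R})
    (hindep : mutually_independent P (driving_events xi U))
    (hxi_id : forall k i (A : set nat), measurable A ->
       distribution P (xi k i) A = distribution P (xi 0%N 0) A)
    (hU : forall k i (A : set R), measurable A ->
       distribution P (U k i) A = uniform_prob (@ltr01 R) A)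
    (lambda : R)
    (hmean : forall k i, 'E_P[fun w => ((xi k i w)%:R)%R]%E = lambda%:E)
    (hlambda : lambda < 1 / \sum_(j \in [set: site d]) a j)
    (hthird : forall k i, ('E_P[fun w => ((xi k i w)%:R ^+ 3)%R] < +oo)%E) :
  stable alg a xi U /\
  (exists mu, lower_invariant alg a xi U mu) /\
  (forall mu, lower_invariant alg a xi U mu ->
     forall i : site d, ('E_mu[fun x : state d => ((x i)%:R ^+ 2)%R] < +oo)%E).
Proof.
have VP := driven_network hindep hxi_id hU.
set V := network_driver xi U in VP.
have qN1 : distribution P (xi 0%N 0) setT = 1%E by rewrite probability_setT.
have mx : measurable_fun setT (fun w => (arrival (V w) 0 0)%:R : R).
  by apply: measurable_fun_natr; apply: measurable_arrival; have [] := VP.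
have lamE : mean P (fun w => (arrival (V w) 0 0)%:R) = lambda%:E.
  by rewrite -(hmean 0%N 0) unlock.
have m3 : (mean P (fun w => ((arrival (V w) 0 0)%:R ^+ 3)%R) < +oo)%E.
  by have := hthird 0%N 0; rewrite unlock.
have m3fin : mean P (fun w => ((arrival (V w) 0 0)%:R ^+ 3)%R) \is a fin_num.
  by rewrite ge0_fin_numE// mean_ge0// => w; rewrite exprn_ge0.
have m2fin : mean P (fun w => ((arrival (V w) 0 0)%:R ^+ 2)%R) \is a fin_num.
  rewrite ge0_fin_numE; last by apply: mean_ge0 => w; rewrite exprn_ge0.
  apply: le_lt_trans m3; apply: le_mean; try exact: measurable_funX.
    by move=> w; rewrite exprn_ge0.
  move=> w; rewrite -!natrX ler_nat; case: (arrival _ _ _) => // n.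
  by rewrite leq_pexp2l.
have sub : lambda < (total_rate ha)^-1.
  by move: hlambda; rewrite (total_rateE ha) div1r.
have [B secondB] : exists B : R, forall n i,
    (mean P (fun w => ((backward a alg n (V w) i)%:R ^+ 2)%R) <= B%:E)%E.
  eexists => n i; rewrite (moment_site ha alg VP 2 n i).
  exact: (moment2_bound alg qN1 VP lamE (esym (fineK m2fin)) (esym (fineK m3fin)) sub).
pose mu := lower_measure ha alg VP.
have mu_stat : stationary alg a xi U mu.
  apply/(stationaryP ha alg hindep hxi_id hU) => k A mA.
  exact: (lower_measure_stationary ha VP secondB k mA).
have mu_low nu : stationary alg a xi U nu -> dominated mu nu.
  move=> /(stationaryP ha alg hindep hxi_id hU).
  exact: (lower_measure_dominated ha VP secondB).
split; first by exists mu.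
split; first by exists mu.
(* Being lower invariant, [nu] is dominated by the stationary law [mu], whose second moments are at
   most [B]. *)
move=> nu [_ nu_low] i; rewrite unlock; apply: le_lt_trans (ltry B).
apply: (dominated_second_moment (nu_low _ mu_stat)).
exact: (lower_measure_second_moment ha VP secondB).
Qed.
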